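(* Let $K$ be a field, $S=K[x_1,\ldots,x_n]$, let $d\ge 2$ be an integer, and let $u,v$ be monomials of degree $d$ of $S$ with $u\geq_{lex} v$. Let $I=(\mathcal{L}(u,v))\subset S$ be the lexsegment ideal generated by $\mathcal{L}(u,v)$. Then $\operatorname{depth}(I)=\operatorname{size}(I)+1$, that is, $I$ has minimal depth.
   Context: The lexicographical order $\geq_{lex}$ on monomials of $S$ is the one induced by $x_1>x_2>\cdots>x_n$. Let $\mathcal{M}_d$ be the set of monomials of degree $d$ of $S$. For $u,v\in\mathcal{M}_d$ with $u\geq_{lex}v$, the lexsegment set is $\mathcal{L}(u,v)=\{w\in\mathcal{M}_d \mid u\geq_{lex}w\geq_{lex}v\}$. A lexsegment ideal is a monomial ideal generated by a lexsegment set. Depth is taken with respect to the graded maximal ideal $\mathfrak m=(x_1,\ldots,x_n)$ of $S$, with ideals regarded as $S$-modules. Size: let $I=\bigcap_{i=1}^s Q_i$ be an irredundant primary decomposition of a nonzero proper monomial ideal $I$, where the $Q_i$ are monomial ideals and $Q_i$ is $P_i$-primary, with the $P_i$ pairwise distinct, so $\operatorname{Ass}(S/I)=\{P_1,\ldots,P_s\}$. Then $\operatorname{size}(I)=a+(n-b)-1$, where $a$ is the minimum number $t$ such that there exist $j_1<\cdots<j_t$ with $\sqrt{\sum_{l=1}^t Q_{j_l}}=\sqrt{\sum_{j=1}^s Q_j}$, and $b=\operatorname{height}(\sum_{j=1}^s Q_j)$. This depends only on $\operatorname{Ass}(S/I)$. The ideal $I$ is said to have minimal depth if $\operatorname{depth}(I)=\operatorname{size}(I)+1$.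 *)

(* Defs.v *)
From HB Require Import structures.
From mathcomp Require Import all_boot all_order all_algebra.
From mathcomp Require Import boolp classical_sets.
From mathcomp Require Export mpoly.

Set Implicit Arguments.
Unset Strict Implicit.
Unset Printing Implicit Defensive.

Import Order.TTheory GRing.Theory.
Local Open Scope classical_set_scope.
Local Open Scope ring_scope.

(* Ideals and submodules are arbitrary [set]s (Prop-valued), so that the
   quantifications over ideals and primes below are unrestricted. *)

Section Ideals.
Variable R : comNzRingType.
Implicit Types I J P Q : set R.

Definition is_ideal I : Prop :=
  [/\ I 0, forall f g, I f -> I g -> I (f + g) & forall a f, I f -> I (a * f)].

Definition ideal_gen (X : set R) : set R := smallest is_ideal X.

Definition radical I : set R := [set f | exists k : nat, I (f ^+ k)].

Definition is_prime P : Prop :=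
  [/\ is_ideal P, ~ P 1 & forall f g, P (f * g) -> P f \/ P g].

Definition is_primary Q : Prop :=
  [/\ is_ideal Q, ~ Q 1 & forall f g, Q (f * g) -> Q f \/ radical Q g].

Definition ideal_sum r (Q : 'I_r -> set R) (A : {set 'I_r}) : set R :=
  [set f | exists2 g : 'I_r -> R,
     forall j, j \in A -> Q j (g j) & f = \sum_(j in A) g j].

(* C 0, ..., C k are primes with C 0 < ... < C k = P; the values of C beyond k
   are irrelevant. *)
Definition prime_chain P (k : nat) (C : nat -> set R) : Prop :=
  [/\ forall i, (i <= k)%N -> is_prime (C i),
      forall i, (i < k)%N -> C i `<` C i.+1 & C k = P].

Definition prime_height P (h : nat) : Prop :=
  (exists C, prime_chain P h C) /\
  (forall k C, prime_chain P k C -> (k <= h)%N).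

Definition has_height J (h : nat) : Prop :=
  (exists P, [/\ is_prime P, J `<=` P & prime_height P h]) /\
  (forall P h', is_prime P -> J `<=` P -> prime_height P h' -> (h <= h')%N).

End Ideals.

Section Depth.
Variables (R : comNzRingType) (M : lmodType R).
Implicit Types (J : set R) (N : set M) (fs : seq R).

Definition is_submod N : Prop :=
  [/\ N 0, forall x y, N x -> N y -> N (x + y) &
      forall a x, N x -> N (a *: x)].

Definition ideal_smul J N : set M :=
  smallest is_submod [set a *: x | a in J & x in N].

(* fs is an N-regular sequence: each fs_i is a nonzerodivisor on
   N / (fs_0, ..., fs_(i-1)) N, and N / (fs) N is nonzero. *)
Definition regular_seq N fs : Prop :=
  (forall i, (i < size fs)%N -> forall x, N x ->
     ideal_smul (ideal_gen [set` take i fs]) N (fs`_i *: x) ->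
     ideal_smul (ideal_gen [set` take i fs]) N x) /\
  ~ (N `<=` ideal_smul (ideal_gen [set` fs]) N).

Definition has_depth J N (k : nat) : Prop :=
  (exists fs, [/\ size fs = k, [set` fs] `<=` J & regular_seq N fs]) /\
  (forall fs, [set` fs] `<=` J -> regular_seq N fs -> (size fs <= k)%N).

End Depth.

Section Monomial.
Variables (K : fieldType) (n : nat).
Implicit Types (I : set {mpoly K[n]}).

Definition monomial_ideal_gen (A : set 'X_{1..n}) : set {mpoly K[n]} :=
  ideal_gen [set ('X_[m] : {mpoly K[n]}) | m in A].

Definition is_monomial_ideal I : Prop := exists A, I = monomial_ideal_gen A.

Definition max_ideal : set {mpoly K[n]} :=
  ideal_gen [set ('X_i : {mpoly K[n]}) | i in [set: 'I_n]].

Definition irredundant_primary_dec I r (Q : 'I_r -> set {mpoly K[n]}) : Prop :=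
  [/\ forall i, is_monomial_ideal (Q i) /\ is_primary (Q i),
      I = \bigcap_(i in [set: 'I_r]) Q i,
      forall i j, i != j -> radical (Q i) <> radical (Q j) &
      forall i, ~ (\bigcap_(j in [set j | j != i]) Q j `<=` Q i)].

Definition spans_radical r (Q : 'I_r -> set {mpoly K[n]}) (A : {set 'I_r}) :=
  radical (ideal_sum Q A) = radical (ideal_sum Q [set: 'I_r]%SET).

(* The natural-number subtractions are not truncated: 1 <= a because I is
   nonzero, and b <= n. *)
Definition has_size I (s : nat) : Prop :=
  [/\ is_monomial_ideal I, I <> [set 0], ~ I 1 &
      exists r (Q : 'I_r -> set {mpoly K[n]}) (a b : nat),
        [/\ irredundant_primary_dec I Q,
            exists2 A, spans_radical Q A & #|A| = a,
            forall A, spans_radical Q A -> (a <= #|A|)%N,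
            has_height (ideal_sum Q [set: 'I_r]%SET) b &
            s = (a + (n - b) - 1)%N]].

(* I is regarded as a submodule of the regular module {mpoly K[n]}^o. *)
Definition depth_ideal I (k : nat) : Prop :=
  has_depth max_ideal (I : set ({mpoly K[n]}^o)) k.

(* size(I) exists, and whichever decomposition computes it,
   depth(I) = size(I) + 1. *)
Definition minimal_depth I : Prop :=
  (exists s, has_size I s) /\ (forall s, has_size I s -> depth_ideal I s.+1).

End Monomial.

(* Pure lexicographic order on exponent vectors, so that x_1 > ... > x_n;
   the canonical order on 'X_{1..n} compares degrees first. *)
Definition lex_ge n (u v : 'X_{1..n}) : bool :=
  ((v : seqlexi nat) <= (u : seqlexi nat))%O.

Definition lexsegment n (d : nat) (u v : 'X_{1..n}) : set 'X_{1..n} :=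
  [set w | [/\ mdeg w = d, lex_ge u w & lex_ge w v]].

Definition lexsegment_ideal (K : fieldType) n (d : nat) (u v : 'X_{1..n}) :
  set {mpoly K[n]} := monomial_ideal_gen (lexsegment d u v).

Arguments lexsegment_ideal K {n} d u v _.

(* Main.v *)
(** Let x_p be the first variable in which u and v differ and let x^mu collect
    their common exponents before p together with x_p^(v_p). Then I = x^mu J,
    where J is generated by a lexsegment whose first monomial is divisible by
    x_p and whose last one is not (J = S when u = v). Let X be the set of
    variables occurring in J. Both depth(I) and size(I) + 1 equal
    (n - |X|) + eps, where eps is the least number of associated primes of S/J
    covering X.

    Let u', v' be the first and the last generator of J. If J is generated in
    degree 1 or x_n u' / x_p >= v', then u' / x_p shows that (X) is an associated
    prime, so that eps = 1. Otherwise x_p occurs with exponent 1 in u', no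
    associated prime contains both x_p and x_n, and (X \ x_p) is associated, so
    that eps = 2.

    Lower bound on the depth: the variables outside X, followed by x_p if
    eps = 1 and by x_p, x_n if eps = 2, form a J-regular sequence. Upper bound:
    a regular sequence of length r in the maximal ideal kills the Koszul
    cohomology of J below degree r, while the socle elements above give an
    explicit nonzero class in degree (n - |X|) + eps.

    The size is read off from the associated primes of an arbitrary irredundant
    monomial primary decomposition; Ass(S/I) is Ass(S/J) together with the
    (x_i) for x_i dividing x^mu. That (X) has height |X| follows from a count of
    variables algebraically independent modulo the primes of a chain. *)

From HB Require Import structures.
Require Import Defs.
From mathcomp Require Import all_boot all_order all_algebra.
From mathcomp Require Import ring zify ring_quotient generic_quotient mxpoly.
From mathcomp Require Import boolp classical_sets.

Set Implicit Arguments.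
Unset Strict Implicit.
Unset Printing Implicit Defensive.

Import Order.TTheory GRing.Theory.
Local Open Scope classical_set_scope.
Local Open Scope ring_scope.

(** * Monomial ideals *)

Section MonomialIdeals.
Variables (K : fieldType) (n : nat).
Local Notation S := {mpoly K[n]}.
Local Notation mon := 'X_{1..n}.
Implicit Types (G H : set mon) (m w t : mon) (f g : S) (X Y : {set 'I_n}).

Definition upset G := forall m m', G m -> (m <= m')%MM -> G m'.

Definition up_closure G : set mon := [set m | exists2 a, G a & (a <= m)%MM].

(** For an up-closed [G] this is the monomial ideal with exponent set [G]; containments of such
    ideals become containments of exponent sets. *)
Definition mon_ideal G : set S := [set f | forall m, m \in msupp f -> G m].

Definition var_set X : set mon := [set m | exists2 i, i \in X & m i != 0%N].

Lemma upset_closure G : upset (up_closure G).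
Proof.
by move=> m m' [a Ga le_am] le_mm'; exists a => //; apply: lepm_trans le_mm'.
Qed.

Lemma upset_var_set X : upset (var_set X).
Proof.
move=> m m' [i iX mi] /mnm_lepP le_mm'; exists i => //.
by rewrite -lt0n (leq_trans _ (le_mm' i)) // lt0n.
Qed.

Lemma upsetD G m m' : upset G -> G m -> G (m + m')%MM.
Proof. by move=> upG Gm; apply: upG Gm _; apply: lem_addr. Qed.

Lemma mon_idealX G m : mon_ideal G 'X_[m] <-> G m.
Proof.
split=> [|Gm m']; first by apply; rewrite msuppX mem_seq1.
by rewrite msuppX mem_seq1 => /eqP ->.
Qed.

Lemma mon_ideal_is_ideal G : upset G -> is_ideal (mon_ideal G).
Proof.
move=> upG; split.
- by move=> m; rewrite msupp0.
- by move=> f g fG gG m /msuppD_le; rewrite mem_cat => /orP[/fG|/gG].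
- move=> a f fG m /msuppM_le /allpairsP[[m1 m2] /= [_ m2f ->]].
  by apply: upG (lem_addl _ _); apply: fG.
Qed.

Lemma ideal_sumP (R : comNzRingType) (I : set R) (T : Type) (r : seq T)
  (P : pred T) (F : T -> R) :
  is_ideal I -> (forall i, P i -> I (F i)) -> I (\sum_(i <- r | P i) F i).
Proof. by case=> I0 ID _ IF; elim/big_rec: _ => // i x Pi; apply/ID/IF. Qed.

Lemma mon_ideal_sub G (I : set S) : is_ideal I ->
  (forall m, G m -> I 'X_[m]) -> mon_ideal G `<=` I.
Proof.
move=> idI GI f fG; rewrite [f]mpolyE big_seq; apply: ideal_sumP => // m mf.
by case: idI => _ _ IM; rewrite -mul_mpolyC; apply/IM/GI/fG.
Qed.

Lemma mon_ideal_subset G H : mon_ideal G `<=` mon_ideal H <-> G `<=` H.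
Proof.
split=> [sGH m /mon_idealX/sGH/mon_idealX //|sGH f fG m /fG /sGH //].
Qed.

Lemma monomial_ideal_genE (A : set mon) :
  monomial_ideal_gen A = mon_ideal (up_closure A) :> set S.
Proof.
apply/seteqP; split.
  apply: smallest_sub; first exact: mon_ideal_is_ideal (@upset_closure _).
  by move=> _ [m Am <-]; apply/mon_idealX; exists m => //; apply: lepm_refl.
apply: mon_ideal_sub => [|m [a Aa /submK <-]].
- split=> [I [[I0 _ _] _] //|f g fA gA I IA|a f fA I IA].
  + by have [[_ ID _] _] := IA; apply: ID; [exact: (fA I IA)|exact: (gA I IA)].
  + by have [[_ _ IM] _] := IA; apply: IM; exact: (fA I IA).
- move=> I [[_ _ IM] sAI]; rewrite mpolyXD; apply: IM.
  by apply: sAI; exists a.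
Qed.

Lemma up_closure_id G : upset G -> up_closure G = G.
Proof.
move=> upG; apply/seteqP; split=> [m [a Ga]|m Gm]; first exact: upG.
by exists m => //; apply: lepm_refl.
Qed.

Lemma is_monomial_idealP (I : set S) :
  is_monomial_ideal I <-> exists2 G, upset G & I = mon_ideal G.
Proof.
split=> [[A ->]|[G upG ->]].
  by exists (up_closure A); [apply: upset_closure | apply: monomial_ideal_genE].
by exists G; rewrite monomial_ideal_genE up_closure_id.
Qed.

End MonomialIdeals.

(** * Prime and primary monomial ideals *)

Section PrimaryMonomialIdeals.
Variables (K : fieldType) (n : nat).
Local Notation S := {mpoly K[n]}.
Local Notation mon := 'X_{1..n}.
Implicit Types (G H : set mon) (m w t : mon) (f g : S) (X Y : {set 'I_n}).

Definition mon_part (P : pred mon) f : S :=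
  \sum_(m <- msupp f | P m) f@_m *: 'X_[m].

Lemma mcoeff_mon_part P f m :
  (mon_part P f)@_m = if P m then f@_m else 0.
Proof.
rewrite /mon_part raddf_sum /=.
under eq_bigr do rewrite mcoeffZ mcoeffX.
rewrite big_mkcond /=; have [mf|mf] := boolP (m \in msupp f); last first.
  rewrite (memN_msupp_eq0 mf) if_same big_seq big1 // => m' m'f.
  by have [e|] := eqVneq m' m; [rewrite e (negPf mf) in m'f | rewrite mulr0 if_same].
rewrite (bigD1_seq m) //= eqxx mulr1 big1 ?addr0 // => m' /negPf ->.
by rewrite mulr0 if_same.
Qed.

Lemma msupp_mon_part P f m :
  (m \in msupp (mon_part P f)) = P m && (m \in msupp f).
Proof. by rewrite !mcoeff_msupp mcoeff_mon_part; case: (P m); rewrite ?eqxx. Qed.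

(* A minimal-weight monomial of [f * g] is a product of minimal-weight monomials:
   the parts of minimal weight have a nonzero product. *)
Lemma min_weight_mul (wt : mon -> nat) f g :
    (forall m1 m2, wt (m1 + m2)%MM = (wt m1 + wt m2)%N) -> f != 0 -> g != 0 ->
  exists m1 m2, [/\ m1 \in msupp f, m2 \in msupp g, (m1 + m2)%MM \in msupp (f * g),
    forall m, m \in msupp f -> (wt m1 <= wt m)%N &
    forall m, m \in msupp g -> (wt m2 <= wt m)%N].
Proof.
move=> wtD.
have minP h : h != 0 -> exists2 k, (exists2 m, m \in msupp h & wt m = k) &
    forall m, m \in msupp h -> (k <= wt m)%N.
  move=> h0; have ex : exists k, has (fun m => wt m == k) (msupp h).
    by exists (wt (mlead h)); apply/hasP; exists (mlead h); rewrite ?mlead_supp.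
  case: (ex_minnP ex) => k /hasP[m mh /eqP mk] mink; exists k; first by exists m.
  by move=> m' m'h; apply: mink; apply/hasP; exists m'.
move=> /minP[k1 [a1 a1f a1k] k1min] /minP[k2 [a2 a2g a2k] k2min].
pose f1 := mon_part (fun m => wt m == k1) f.
pose g1 := mon_part (fun m => wt m == k2) g.
have f1_0 : f1 != 0.
  apply/eqP => e; have : a1 \in msupp f1 by rewrite msupp_mon_part a1k eqxx.
  by rewrite e msupp0.
have g1_0 : g1 != 0.
  apply/eqP => e; have : a2 \in msupp g1 by rewrite msupp_mon_part a2k eqxx.
  by rewrite e msupp0.
have [m mfg] : exists m, m \in msupp (f1 * g1).
  by exists (mlead (f1 * g1)); rewrite mlead_supp // mulf_neq0.
have /msuppM_le/allpairsP[[m1 m2] /= [m1f1 m2g1 em]] := mfg.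
move: m1f1 m2g1; rewrite !msupp_mon_part => /andP[/eqP m1k m1f] /andP[/eqP m2k m2g].
have wtm : wt m = (k1 + k2)%N by rewrite em wtD m1k m2k.
exists m1, m2; split=> //; last 2 first.
- by move=> m' /k1min; rewrite m1k.
- by move=> m' /k2min; rewrite m2k.
rewrite -em; move: mfg; rewrite !mcoeff_msupp.
(* The other two products only have monomials of weight above [k1 + k2], so they do not contribute
   to the coefficient at [m]. *)
have -> : f * g = f1 * g1 + (f1 * (g - g1) + (f - f1) * g) by ring.
rewrite mcoeffD [X in _ + X]memN_msupp_eq0 ?addr0 //.
apply/negP => /msuppD_le; rewrite mem_cat.
case/orP=> /msuppM_le/allpairsP[[b1 b2] /= [b1f b2g eb]].
  move: b1f b2g; rewrite msupp_mon_part => /andP[/eqP b1k _].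
  rewrite mcoeff_msupp mcoeffB mcoeff_mon_part.
  case: ifP => [_|b2k]; first by rewrite subrr eqxx.
  rewrite subr0 -mcoeff_msupp => /k2min le.
  move: wtm; rewrite eb wtD b1k => /addnI e; by rewrite e eqxx in b2k.
move: b1f b2g; rewrite mcoeff_msupp mcoeffB mcoeff_mon_part.
case: ifP => [_|b1k]; first by rewrite subrr eqxx.
rewrite subr0 -mcoeff_msupp => /k1min le1 /k2min le2.
have lt1 : (k1 < wt b1)%N by rewrite ltn_neqAle le1 andbT eq_sym b1k.
by have := leq_add lt1 le2; rewrite addSn -wtD -eb wtm ltnn.
Qed.

Definition var_weight X m := (\sum_(i in X) m i)%N.

Lemma var_weightD X m1 m2 :
  var_weight X (m1 + m2)%MM = (var_weight X m1 + var_weight X m2)%N.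
Proof. by rewrite /var_weight -big_split; apply: eq_bigr => i _; rewrite mnmDE. Qed.

Lemma var_setP X m : var_set X m <-> var_weight X m != 0%N.
Proof.
rewrite /var_weight sum_nat_eq0; split=> [[i iX mi]|].
  by apply/negP => /forall_inP/(_ i iX); rewrite (negPf mi).
by case/forall_inPn => i iX mi; exists i.
Qed.

Definition prime_vars X : set S := mon_ideal (var_set X).

Lemma prime_vars_is_prime X : is_prime (prime_vars X).
Proof.
split; first exact: mon_ideal_is_ideal (@upset_var_set _ _).
  move=> /(_ 0%MM); rewrite msupp1 mem_seq1 => /(_ (eqxx _)) [i _].
  by rewrite mnm0E.
move=> f g fgP.
have [->|f0] := eqVneq f 0; first by left => m; rewrite msupp0.
have [->|g0] := eqVneq g 0; first by right => m; rewrite msupp0.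
(* If both minimal weights vanished, [f * g] would have a monomial free of the variables in [X]. *)
have [m1 [m2 [m1f m2g /fgP /var_setP m12 min1 min2]]] :=
  min_weight_mul (var_weightD X) f0 g0.
move: m12; rewrite var_weightD addn_eq0 negb_and => /orP[w1|w2].
  left=> m /min1 le; apply/var_setP; rewrite -lt0n (leq_trans _ le) //.
  by rewrite lt0n.
right=> m /min2 le; apply/var_setP; rewrite -lt0n (leq_trans _ le) //.
by rewrite lt0n.
Qed.

Lemma prime_pow (R : comNzRingType) (P : set R) (x : R) k :
  is_prime P -> P (x ^+ k) -> P x.
Proof.
case=> _ P1 PM; elim: k => [/P1 //|k IHk]; rewrite exprS => /PM[] //.
Qed.

Lemma uniform_exponent X G : upset G ->
  (forall i, i \in X -> exists N, G (U_(i) *+ N)%MM) ->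
  exists N, forall i, i \in X -> G (U_(i) *+ N)%MM.
Proof.
move=> upG exN.
have [N NP] : exists N : 'I_n -> nat, forall i, i \in X -> G (U_(i) *+ N i)%MM.
  have /choice[N NP] : forall i, exists N, i \in X -> G (U_(i) *+ N)%MM.
    move=> i; have [/exN[N GN]|iX] := boolP (i \in X); first by exists N.
    by exists 0%N.
  by exists N.
exists (\max_i N i)%N => i /NP/upG; apply; apply/mnm_lepP => j.
by rewrite !mulmnE leq_mul2l leq_bigmax orbT.
Qed.

(** By pigeonhole, some variable of [X] occurs in [m] with exponent at least [N]. *)
Lemma weight_ge_mem X G N m : upset G ->
  (forall i, i \in X -> G (U_(i) *+ N)%MM) ->
  (#|X| * N < var_weight X m)%N -> G m.
Proof.
move=> upG GN lt; have /existsP[i /andP[iX Ni]] : [exists i, (i \in X) && (N <= m i)%N].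
  apply: contraLR lt; rewrite negb_exists => /forallP all.
  rewrite -leqNgt /var_weight -sum_nat_const; apply: leq_sum => i iX.
  by have := all i; rewrite iX /= -ltnNge => /ltnW.
apply: upG (GN i iX) _; apply/mnm_lepP => j; rewrite mulmnE mnm1E.
by case: eqP => [<-|_]; rewrite ?mul1n ?mul0n.
Qed.

Lemma radical_mon_ideal G X : upset G -> G `<=` var_set X ->
    (forall i, i \in X -> exists N, G (U_(i) *+ N)%MM) ->
  radical (mon_ideal G) = prime_vars X.
Proof.
move=> upG GX /(uniform_exponent upG)[N GN]; apply/seteqP; split=> [f [k fk]|f fX].
  apply: (@prime_pow _ _ _ k (prime_vars_is_prime X)).
  by move=> m /fk/GX.
(* Every monomial of [f] has weight at least 1 in [X], so those of this power exceed the bound of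
   [weight_ge_mem]. *)
exists (#|X| * N).+1 => m mf; apply: (weight_ge_mem upG GN).
elim: (_.+1) m mf => [//|k IHk] m; rewrite exprS.
case/msuppM_le/allpairsP=> [[m1 m2] /= [/fX/var_setP m1f /IHk m2f ->]].
by rewrite var_weightD -add1n leq_add // lt0n.
Qed.

(* The exponents of a monomial ideal which is primary to [prime_vars X]. *)
Definition primary_exps G X := [/\ upset G, ~ G 0%MM,
  forall m i, i \notin X -> G (m + U_(i))%MM -> G m &
  forall i, i \in X -> exists N, G (U_(i) *+ N)%MM].

(** All variables of [m'] lie outside [X], and they are cancelled one at a time. *)
Lemma free_exps G X m m' : (forall m i, i \notin X -> G (m + U_(i))%MM -> G m) ->
  var_weight X m' = 0%N -> G (m + m')%MM -> G m.
Proof.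
move=> freeG; elim/(@ltmwf n): m' m => m' IH m wm'.
have [->|] := eqVneq m' 0%MM; first by rewrite addm0.
rewrite -mdeg_eq0 mdegE sum_nat_eq0 => /forall_inPn[i _ mi].
have e : m' = (m' - U_(i) + U_(i))%MM by rewrite submK // lep1mP.
have iX : i \notin X.
  apply/negP => iX; move/eqP: wm'; rewrite /var_weight sum_nat_eq0.
  by move/forall_inP/(_ i iX); rewrite (negPf mi).
rewrite {1}e addmA => /freeG -/(_ iX); apply: IH.
  by apply: lt_mdeg_ltmc; rewrite [X in (_ < mdeg X)%N]e mdegD mdeg1 addn1.
by apply/eqP; move/eqP: wm'; rewrite {1}e var_weightD addn_eq0 => /andP[].
Qed.

Lemma primary_exps_sub G X : primary_exps G X -> G `<=` var_set X.
Proof.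
move=> prG m Gm; apply/var_setP/eqP => wm.
have [_ G0 _ _] := prG; apply: G0; have [_ _ freeG _] := prG; apply: (free_exps freeG wm).
by rewrite add0m.
Qed.

Lemma primary_exps_radical G X : primary_exps G X ->
  radical (mon_ideal G) = prime_vars X.
Proof.
by move=> prG; have [upG _ _ exN] := prG; apply/radical_mon_ideal/exN/primary_exps_sub.
Qed.

(** If [g] is not in the radical, it has a monomial free of [X]. After dropping from [f] its
    monomials in [G], the product still has a monomial [m1 + m2] with [m1] outside [G] and [m2] free
    of [X], which cannot lie in [G]. *)
Lemma primary_exps_is_primary G X : primary_exps G X ->
  is_primary (mon_ideal G : set S).
Proof.
move=> prG; have [upG G0 freeG exN] := prG.
split; first exact: mon_ideal_is_ideal.
  by move=> /(_ 0%MM); rewrite msupp1 mem_seq1 => /(_ (eqxx _)).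
move=> f g fgG; have [gX|gX] := pselect (prime_vars X g).
  by right; rewrite (primary_exps_radical prG).
left=> m0 m0f; apply: contrapT => Gm0.
pose f' := mon_part (fun m => `[< ~ G m >]) f.
have f'0 : f' != 0.
  apply/eqP => e; have : m0 \in msupp f' by rewrite msupp_mon_part m0f andbT; apply/asboolP.
  by rewrite e msupp0.
have [m2' m2'g w2'] : exists2 m, m \in msupp g & var_weight X m = 0%N.
  apply: contrapT => h; apply: gX => m mg; apply/var_setP/eqP => wm.
  by apply: h; exists m.
have g0 : g != 0 by apply/eqP => e; rewrite e msupp0 in m2'g.
have [m1 [m2 [m1f m2g m12 _ min2]]] := min_weight_mul (var_weightD X) f'0 g0.
have w2 : var_weight X m2 = 0%N.
  by apply/eqP; rewrite -leqn0 -w2' min2.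
move: m1f; rewrite msupp_mon_part => /andP[/asboolP nGm1 _]; apply: nGm1.
apply: (free_exps freeG w2).
have [_ ID IM] := mon_ideal_is_ideal K upG.
suff: mon_ideal G (f' * g) by apply.
have -> : f' * g = f * g + (- g) * (f - f') by ring.
apply: ID => //; apply: IM => m.
rewrite mcoeff_msupp mcoeffB mcoeff_mon_part; case: asboolP => [_|/contrapT //].
by rewrite subrr eqxx.
Qed.

End PrimaryMonomialIdeals.

(** * Height of ideals generated by variables *)

Section QuotientByPrime.
Variables (R : comNzRingType) (P : set R).
Hypothesis primeP : is_prime P.

Definition prime_pred : pred R := fun f => `[< P f >].

Lemma prime_pred_ideal : idealr_closed prime_pred.
Proof.
have [[P0 PD PM] P1 _] := primeP; split.
- exact/asboolP.
- exact/asboolP.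
- move=> a f g /asboolP fP /asboolP gP; apply/asboolP; apply: PD => //.
  exact: PM.
Qed.

HB.instance Definition _ := isIdealr.Build R prime_pred prime_pred_ideal.

(** The target is the quotient by [P], presented through a morphism with kernel [P] whose image has
    no zero divisors. *)
Lemma prime_kernel : exists (E : comNzRingType) (phi : {rmorphism R -> E}),
  (forall f, phi f = 0 <-> P f) /\
  (forall f g, phi f * phi g = 0 -> phi f = 0 \/ phi g = 0).
Proof.
pose E : comNzRingType := {ideal_quot (prime_pred : idealr R)}.
pose phi : {rmorphism R -> E} := \pi_({ideal_quot (prime_pred : idealr R)})%qT.
exists E, phi.
have ker f : phi f = 0 <-> P f.
  rewrite -(rmorph0 phi); split=> [/eqP|fP].
    by rewrite -Quotient.idealrBE subr0 => /asboolP.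
  by apply/eqP; rewrite -Quotient.idealrBE subr0; apply/asboolP.
split=> // f g; rewrite -rmorphM => /ker.
by have [_ _ prP] := primeP; move/prP => [/ker|/ker]; [left|right].
Qed.

End QuotientByPrime.

(** * Algebraic independence along chains of primes *)

Section IndependenceModuloPrimes.
Variables (K : fieldType) (n : nat).
Local Notation S := {mpoly K[n]}.
Implicit Types (P Q : set S) (X Y Z : {set 'I_n}).

Lemma mpoly_rmorph_ext (R : comNzRingType) (phi psi : {rmorphism S -> R}) :
    (forall c, phi c%:MP = psi c%:MP) -> (forall i, phi 'X_i = psi 'X_i) ->
  phi =1 psi.
Proof.
move=> eC eX f; rewrite [f]mpolyE !rmorph_sum; apply: eq_bigr => m _.
rewrite -mul_mpolyC !rmorphM eC; congr (_ * _).
by rewrite mpolyXE_id !rmorph_prod; apply: eq_bigr => i _; rewrite !rmorphXn eX.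
Qed.

(** The retraction of [S] onto the polynomial subring in the variables of [Y]; its image stands for
    that subring. *)
Definition proj_vars Y : {rmorphism S -> S} :=
  mmap (@mpolyC n K) (fun i => if i \in Y then 'X_i else 0).

Lemma proj_varsC Y c : proj_vars Y c%:MP = c%:MP.
Proof. exact: mmapC. Qed.

Lemma proj_varsX Y i : proj_vars Y 'X_i = if i \in Y then 'X_i else 0.
Proof. by rewrite [LHS]mmapX mmap1U. Qed.

Lemma proj_vars_sub Y Z f : Y \subset Z ->
  proj_vars Z (proj_vars Y f) = proj_vars Y f.
Proof.
move=> sYZ; apply: (@mpoly_rmorph_ext _ (proj_vars Z \o proj_vars Y) (proj_vars Y)).
  by move=> c /=; rewrite !proj_varsC.
move=> i /=; rewrite proj_varsX; case: ifP => [iY|_]; last by rewrite rmorph0.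
by rewrite proj_varsX (fintype.subsetP sYZ).
Qed.

(* The variables in [Y] are algebraically independent modulo [P]. *)
Definition indep_mod P Y := forall f, P (proj_vars Y f) -> proj_vars Y f = 0.

(** Setting the variables of [X] to zero kills [prime_vars X] and fixes the polynomials in the other
    variables. *)
Lemma indep_modC X : indep_mod (prime_vars X : set S) (~: X).
Proof.
move=> f fX; rewrite -(@proj_vars_sub _ (~: X) f) //.
rewrite [proj_vars _ f]mpolyE rmorph_sum big_seq big1 // => m /fX[i iX mi].
have -> : m = (m - U_(i) + U_(i))%MM by rewrite submK // lep1mP.
rewrite mpolyXD scalerAl rmorphM /= [X in _ * X]proj_varsX inE iX /=.
by rewrite mulr0.
Qed.

Section Algebraic.
Variables (E : comNzRingType) (phi : {rmorphism S -> E}).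
Hypothesis phiM : forall f g, phi f * phi g = 0 -> phi f = 0 \/ phi g = 0.
Variables (Y : {set 'I_n}).

Let psi : {rmorphism S -> E} := phi \o proj_vars Y.

Let psiM f g : psi f != 0 -> psi g != 0 -> psi (f * g) != 0.
Proof.
move=> /eqP f0 /eqP g0; apply/eqP; rewrite rmorphM => /phiM[] //.
Qed.

(* [u] is algebraic over the fraction field of the image of [psi]. *)
Definition algebraic_mod u := exists2 c, psi c != 0 & integralOver psi (psi c * u).

Lemma integral_lead (q : {poly E}) x : (forall k, integralOver psi q`_k) ->
  q != 0 -> root q x -> integralOver psi (lead_coef q * x).
Proof.
move=> intq q0 /rootP qx; set l := lead_coef q.
have szq : (1 < size q)%N.
  rewrite ltnNge; apply/negP => /size1_polyC e; move: qx q0.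
  by rewrite e hornerC => ->; rewrite eqxx.
pose d := (size q).-1; have d_gt0 : (0 < d)%N by rewrite /d -subn1 subn_gt0.
have szE : size q = d.+1 by rewrite /d prednK // ltnW.
(* Clearing the leading coefficient: [r] is monic and its value at [l * x] is [l ^+ d.-1] times that
   of [q] at [x]. *)
pose r := \poly_(k < d.+1) (if k == d then 1 else q`_k * l ^+ (d.-1 - k)).
apply: (@integral_root_monic _ _ _ _ r).
- rewrite monicE lead_coef_poly ?eqxx //.
  exact: oner_neq0.
- apply/rootP; rewrite horner_poly.
  transitivity (l ^+ d.-1 * q.[x]); last by rewrite qx mulr0.
  rewrite horner_coef szE mulr_sumr; apply: eq_bigr => k _.
  rewrite exprMn; case: eqP => [->|/eqP kd].
    have -> : q`_d = l by [].
    by rewrite mul1r mulrA -exprSr prednK.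
  have kd1 : (k <= d.-1)%N.
    by have := ltn_ord k; move: kd d_gt0; clearbody d; clear; lia.
  by rewrite -{2}(subnK kd1) exprD; ring.
- apply/integral_poly => k; rewrite coef_poly; case: ifP => _; last exact: integral0.
  case: ifP => _; first exact: integral1.
  apply: integral_mul => //; elim: (_ - _)%N => [|j IHj]; first exact: integral1.
  by rewrite exprS; apply: integral_mul => //; apply: intq.
Qed.

Lemma algebraic_modD u v : algebraic_mod u -> algebraic_mod v -> algebraic_mod (u + v).
Proof.
move=> [c c0 iu] [d d0 iv]; exists (c * d); first exact: psiM.
have -> : psi (c * d) * (u + v) = psi d * (psi c * u) + psi c * (psi d * v).
  by rewrite rmorphM; ring.
by apply: integral_add; apply: integral_mul => //; apply: integral_id.
Qed.

Lemma algebraic_modM u v : algebraic_mod u -> algebraic_mod v -> algebraic_mod (u * v).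
Proof.
move=> [c c0 iu] [d d0 iv]; exists (c * d); first exact: psiM.
have -> : psi (c * d) * (u * v) = (psi c * u) * (psi d * v).
  by rewrite rmorphM; ring.
exact: integral_mul.
Qed.

Lemma algebraic_mod_id a : algebraic_mod (psi a).
Proof.
exists 1; first by rewrite rmorph1 oner_neq0.
by rewrite rmorph1 mul1r; apply: integral_id.
Qed.

Lemma algebraic_mod_gen :
  (forall i, algebraic_mod (phi 'X_i)) -> forall f, algebraic_mod (phi f).
Proof.
have algC c : algebraic_mod (phi c%:MP).
  by have := algebraic_mod_id c%:MP; rewrite /psi /= proj_varsC.
move=> algX f; rewrite [f]mpolyE rmorph_sum.
elim/big_ind: _ => [||m _]; first by rewrite -(rmorph0 psi); apply: algebraic_mod_id.
  exact: algebraic_modD.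
rewrite -mul_mpolyC rmorphM; apply: algebraic_modM => //.
rewrite mpolyXE_id rmorph_prod.
elim/big_ind: _ => [||i _]; first by rewrite -(rmorph1 psi); apply: algebraic_mod_id.
  exact: algebraic_modM.
elim: (m i) => [|k IHk]; first by rewrite rmorph1 -(rmorph1 psi); apply: algebraic_mod_id.
by rewrite exprS rmorphM; apply: algebraic_modM.
Qed.

(** The relation [f] is read as a polynomial in [x_i] over the subring of [Y]; its leading
    coefficient survives under [phi] because the variables of [Y] are independent. *)
Lemma dependent_algebraic i : i \notin Y ->
    (forall f, phi (proj_vars Y f) = 0 -> proj_vars Y f = 0) ->
    (exists2 f, phi (proj_vars (i |: Y) f) = 0 & proj_vars (i |: Y) f != 0) ->
  algebraic_mod (phi 'X_i).
Proof.
move=> iY phiY [f f0 fn0].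
(* Variables of [Y] become constants and [x_i] the indeterminate; evaluation at [x_i] recovers the
   relation. *)
pose theta : {rmorphism S -> {poly S}} := mmap (polyC \o @mpolyC n K)
  (fun j => if j \in Y then ('X_j)%:P else if j == i then 'X else 0).
have thetaC c : theta c%:MP = c%:MP%:P by exact: mmapC.
have thetaX j : theta 'X_j = if j \in Y then ('X_j)%:P else if j == i then 'X else 0.
  by rewrite [LHS]mmapX mmap1U.
pose p := theta (proj_vars (i |: Y) f).
have pX : p.['X_i] = proj_vars (i |: Y) f.
  apply: (@mpoly_rmorph_ext _ (horner_eval 'X_i \o (theta \o proj_vars (i |: Y)))
     (proj_vars (i |: Y))) => [c|j] /=.
    by rewrite proj_varsC thetaC /horner_eval hornerC.
  rewrite proj_varsX !inE; case: eqP => [->|/eqP ji] /=.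
    by rewrite thetaX (negPf iY) eqxx /horner_eval hornerX.
  case: ifP => jY; last by rewrite rmorph0 /horner_eval horner0.
  by rewrite thetaX jY /horner_eval hornerC.
have pY : map_poly (proj_vars Y) p = p.
  apply: (@mpoly_rmorph_ext _ (map_poly (proj_vars Y) \o theta) theta) => [c|j] /=.
    by rewrite thetaC map_polyC /= proj_varsC.
  rewrite thetaX; case: ifP => jY; first by rewrite map_polyC /= proj_varsX jY.
  by case: ifP => _; rewrite ?map_polyX ?rmorph0.
have p0 : p != 0.
  by apply: contraNneq fn0 => e; rewrite -pX e horner0.
have qE : map_poly psi p = map_poly phi p by rewrite map_poly_comp pY.
have lp : phi (lead_coef p) != 0.
  apply/eqP => l0; have e : proj_vars Y (lead_coef p) = lead_coef p.
    by rewrite -[in RHS]pY lead_coefE -coef_map pY -lead_coefE.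
  have := phiY (lead_coef p); rewrite e => /(_ l0)/eqP.
  by rewrite lead_coef_eq0 (negPf p0).
have lq : lead_coef (map_poly psi p) = psi (lead_coef p).
  apply: lead_coef_map_eq; rewrite /psi /=.
  by rewrite lead_coefE -coef_map pY -lead_coefE.
have psil : psi (lead_coef p) != 0.
  by rewrite /psi /= lead_coefE -coef_map pY -lead_coefE.
exists (lead_coef p) => //; rewrite -lq; apply: integral_lead.
- by move=> k; rewrite coef_map; apply: integral_id.
- by rewrite -lead_coef_eq0 lq.
- by apply/rootP; rewrite qE horner_map /= pX.
Qed.

(* The constant term of a nontrivial relation for [g] over [psi], after
   cancelling powers of [g], is a multiple of [g] modulo the kernel. *)
Lemma algebraic_multiple g : phi g != 0 -> algebraic_mod (phi g) ->
  exists a b, phi (proj_vars Y a) = phi (g * b) /\ phi (proj_vars Y a) != 0.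
Proof.
move=> g0 [c c0 [h mon_h /rootP hx]].
(* The powers of [c] are moved into the coefficients, so that [phi g] itself is a root; the leading
   coefficient becomes a power of [c], nonzero under [psi]. *)
pose h2 := \poly_(k < size h) (h`_k * c ^+ k).
have h2_0 : map_poly psi h2 != 0.
  apply/eqP => /(congr1 (fun q : {poly E} => q`_(size h).-1)).
  have sz : ((size h).-1 < size h)%N by rewrite prednK // size_poly_gt0 monic_neq0.
  rewrite coef_map coef_poly sz coef0 -lead_coefE (monicP mon_h) mul1r.
  suff : psi (c ^+ (size h).-1) != 0 by move/eqP.
  elim: (_.-1) => [|k IHk]; first by rewrite rmorph1 oner_neq0.
  by rewrite exprS; apply: psiM.
have coefP (q : {poly S}) k : (map_poly psi q)`_k = psi q`_k by rewrite coef_map.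
have h2x : (map_poly psi h2).[phi g] = 0.
  rewrite -{}hx (@horner_coef_wide _ (size h)) ?(leq_trans (size_poly _ _)) ?size_poly //.
  rewrite (@horner_coef_wide _ (size h)) ?size_poly //.
  apply: eq_bigr => k _; rewrite !coefP coef_poly ltn_ord.
  by rewrite rmorphM rmorphXn exprMn mulrA.
elim/poly_ind: h2 h2_0 h2x => [|q a IHq]; first by rewrite rmorph0 eqxx.
have -> : map_poly psi (q * 'X + a%:P) = map_poly psi q * 'X + (psi a)%:P.
  by rewrite rmorphD rmorphM /= map_polyX map_polyC.
move=> qa0.
rewrite hornerD hornerM hornerX hornerC => e.
have [pa0|pa0] := eqVneq (psi a) 0.
  apply: IHq.
    by apply: contraNneq qa0 => ->; rewrite mul0r add0r pa0 polyC0.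
  move: e; rewrite pa0 addr0 map_poly_comp horner_map /= => /phiM[] // /eqP.
  by rewrite (negPf g0).
exists a, (- (map_poly (proj_vars Y) q).[g]); split; last exact: pa0.
have -> : phi (proj_vars Y a) = psi a by [].
rewrite rmorphM rmorphN -horner_map -map_poly_comp.
move/eqP: e; rewrite addrC addr_eq0 => /eqP ->.
by rewrite mulrN mulrC.
Qed.

End Algebraic.

(* The transcendence degree drops along [P < Q]: otherwise every variable would
   be algebraic over [Y] modulo [P], and an element of [Q] outside [P] would have
   a multiple that is a nonzero polynomial in [Y] modulo [P]. *)
Lemma indep_mod_grow P Q Y : is_prime P -> is_prime Q -> P `<` Q ->
  indep_mod Q Y -> exists2 i, i \notin Y & indep_mod P (i |: Y).
Proof.
move=> prP prQ [sPQ /existsNP[g /not_implyP[Qg nPg]]] indQ; apply: contrapT => noi.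
have [E [phi [ker phiM]]] := prime_kernel prP.
have algX i : algebraic_mod phi Y (phi 'X_i).
  have [iY|iY] := boolP (i \in Y).
    by have := algebraic_mod_id phi Y 'X_i; rewrite /= proj_varsX iY.
  apply: dependent_algebraic => //.
    by move=> f /ker/sPQ/indQ.
  apply: contrapT => nof; apply: noi; exists i => // f /ker f0.
  by apply: contrapT => /eqP f1; apply: nof; exists f.
have g0 : phi g != 0 by apply/eqP => /ker.
have [a [b [e a0]]] := algebraic_multiple phiM g0 (algebraic_mod_gen phiM algX g).
case/eqP: a0; rewrite (indQ a) ?rmorph0 //.
have [[_ QD QM] _ _] := prQ.
have -> : proj_vars Y a = (proj_vars Y a - g * b) + b * g by ring.
by apply: QD; [apply/sPQ/ker; rewrite rmorphB e subrr | apply: QM].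
Qed.

(** At the top of the chain the variables outside [X] are independent. Each strict step down adds
    one variable by [indep_mod_grow], and there are only [n] variables. *)
Lemma prime_vars_chain_bound X k C :
  prime_chain (prime_vars X : set S) k C -> (k <= #|X|)%N.
Proof.
case=> prC ltC Ck.
suff [Y _ cY] : exists2 Y, indep_mod (C 0%N) Y & (#|~: X| + k <= #|Y|)%N.
  have := leq_trans cY (max_card _); rewrite -(cardsC X).
  by rewrite addnC leq_add2r.
suff H j : (j <= k)%N ->
    exists2 Y, indep_mod (C (k - j)%N) Y & (#|~: X| + j <= #|Y|)%N.
  by have := H k (leqnn k); rewrite subnn.
elim: j => [_|j IHj ltjk].
  by exists (~: X); rewrite ?addn0 // subn0 Ck; apply: indep_modC.
have [Y indY cY] := IHj (ltnW ltjk).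
have e : (k - j = (k - j.+1).+1)%N by lia.
have lt' : (k - j.+1 < k)%N by lia.
have [i iY indiY] : exists2 i, i \notin Y & indep_mod (C (k - j.+1)%N) (i |: Y).
  apply: (@indep_mod_grow _ (C (k - j)%N)) => //.
  - by apply: prC; apply: leq_subr.
  - by apply: prC; apply: leq_subr.
  - by rewrite e; apply: ltC.
by exists (i |: Y); rewrite // cardsU1 iY add1n addnS ltnS.
Qed.

End IndependenceModuloPrimes.

Section HeightOfVariables.
Variables (K : fieldType) (n : nat).
Local Notation S := {mpoly K[n]}.
Implicit Types (P J : set S) (X : {set 'I_n}).

Lemma prime_varsX X i : (prime_vars X : set S) 'X_i <-> i \in X.
Proof.
split=> [/mon_idealX[j jX]|iX].
  by rewrite mnm1E; case: (eqVneq i j) => [->|].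

by apply/mon_idealX; exists i => //; rewrite mnm1E eqxx.
Qed.

Lemma prime_vars_subset X Y :
  (prime_vars X : set S) `<=` prime_vars Y <-> X \subset Y.
Proof.
split=> [sXY|/fintype.subsetP sXY].
  by apply/fintype.subsetP => i /prime_varsX/sXY/prime_varsX.
by apply/mon_ideal_subset => m [i /sXY iY mi]; exists i.
Qed.

Lemma prime_vars_inj : injective (@prime_vars K n).
Proof.
by move=> X Y e; apply/eqP; rewrite finset.eqEsubset; apply/andP; split;
  apply/prime_vars_subset; rewrite e.
Qed.

Let take_vars X i : {set 'I_n} := [set j in take i (enum X)].

Let card_take_vars X i : (i <= #|X|)%N -> #|take_vars X i| = i.
Proof.
move=> iX; rewrite cardsE.
have /card_uniqP -> : uniq (take i (enum X)) by rewrite take_uniq ?enum_uniq.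
by rewrite size_take -cardE; case: ltnP => // le; apply/eqP; rewrite eqn_leq iX le.
Qed.

Lemma prime_vars_chain_to X P : is_prime P -> prime_vars X `<=` P ->
  exists C, prime_chain P #|X| C.
Proof.
move=> prP sXP.
(* The variables of [X] are added one by one, and the last prime is replaced by [P], which may be
   larger than [prime_vars X]. *)
exists (fun i => if (i < #|X|)%N then prime_vars (take_vars X i) else P); split.
- by move=> i _; case: ifP => _ //; apply: prime_vars_is_prime.
- move=> i iX; rewrite iX.
  have lt : prime_vars (take_vars X i) `<` (prime_vars (take_vars X i.+1) : set S).
    split.
      apply/prime_vars_subset/fintype.subsetP => j; rewrite !inE.
      have -> : take i (enum X) = take i (take i.+1 (enum X)) by rewrite take_takel.
      exact: mem_take.
    move/prime_vars_subset/subset_leq_card.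
    by rewrite !card_take_vars ?ltnn // ltnW.
  case: ifP => // Xi; have e : i.+1 = #|X| by lia.
  have eX : take_vars X i.+1 = X.
    by apply/finset.setP => j; rewrite inE e cardE take_size mem_enum.
  move: lt; rewrite eX => -[l1 l2]; split; first exact: subset_trans sXP.
  by move=> sP; apply: l2; apply: subset_trans sP.
- by rewrite ltnn.
Qed.

Lemma prime_vars_height X : prime_height (prime_vars X : set S) #|X|.
Proof.
split; last by move=> k C; apply: prime_vars_chain_bound.
by apply: prime_vars_chain_to => //; apply: prime_vars_is_prime.
Qed.

(** A prime containing [J] contains a power of each variable of [X], hence contains [prime_vars X],
    which is itself a prime over [J]. *)
Lemma has_height_prime_vars J X b : J `<=` prime_vars X ->
  (forall i, i \in X -> exists N, J ('X_i ^+ N)) ->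
  has_height J b <-> b = #|X|.
Proof.
move=> sJX XJ.
have le P h : is_prime P -> J `<=` P -> prime_height P h -> (#|X| <= h)%N.
  move=> prP sJP [_ ph]; have sXP : prime_vars X `<=` P.
    apply: mon_ideal_sub => [|m [i iX mi]]; first by have [] := prP.
    have [[_ _ PM] _ _] := prP.
    have -> : m = (m - U_(i) + U_(i))%MM by rewrite submK // lep1mP.
    rewrite mpolyXD; apply: PM; have [N /sJP] := XJ i iX; exact: prime_pow.
  by have [C] := prime_vars_chain_to prP sXP; apply: ph.
split=> [[[P [prP sJP hP]] minb]|->].
  apply/eqP; rewrite eqn_leq (le P b) // andbT.
  by apply: minb sJX (prime_vars_height X); apply: prime_vars_is_prime.
split=> //; exists (prime_vars X); split=> //.
  exact: prime_vars_is_prime.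
exact: prime_vars_height.
Qed.

End HeightOfVariables.

(** * Associated primes and size *)

Section AssociatedPrimes.
Variables (K : fieldType) (n : nat).
Local Notation S := {mpoly K[n]}.
Local Notation mon := 'X_{1..n}.
Implicit Types (G H : set mon) (m w t : mon) (f g : S) (X Y : {set 'I_n}).

(* [x^w] witnesses that the ideal [prime_vars X] is a colon ideal of
   [mon_ideal G]. *)
Definition assoc_vars G X w :=
  (forall k, k \in X -> G (w + U_(k))%MM) /\
  (forall m, var_weight X m = 0%N -> ~ G (w + m)%MM).

Definition assoc_primes G : {set {set 'I_n}} := [set X | `[< exists w, assoc_vars G X w >]].

Lemma assoc_primesP G X : reflect (exists w, assoc_vars G X w) (X \in assoc_primes G).
Proof. by rewrite inE; apply: asboolP. Qed.

Lemma primary_mon_ideal_exps G : upset G -> is_primary (mon_ideal G : set S) ->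
  exists X, primary_exps G X.
Proof.
move=> upG [_ Q1 prQ]; exists [set i | `[< exists N, G (U_(i) *+ N)%MM >]]%SET; split=> //.
- move=> G0; apply: Q1 => m _; apply: upG G0 _; apply/mnm_lepP => i.
  by rewrite mnm0E.
- move=> m i iX /mon_idealX -/(_ K); rewrite mpolyXD => /prQ[/mon_idealX //|].
  case=> N; rewrite mpolyXn => /mon_idealX GN; move: iX; rewrite inE.
  by move/asboolP; case; exists N.
- by move=> i; rewrite inE => /asboolP.
Qed.

Lemma dec_exps (I : set S) r (Q : 'I_r -> set S) : irredundant_primary_dec I Q ->
  exists (Gs : 'I_r -> set mon) Xs,
    (forall i, Q i = mon_ideal (Gs i)) /\ (forall i, primary_exps (Gs i) (Xs i)).
Proof.
case=> prQ _ _ _.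
have /choice[GX GXP] : forall i, exists GX : set mon * {set 'I_n},
    Q i = mon_ideal GX.1 /\ primary_exps GX.1 GX.2.
  move=> i; have [/is_monomial_idealP[G upG e]] := prQ i; rewrite e.
  by case/(primary_mon_ideal_exps upG) => X GX; exists (G, X).
by exists (fst \o GX), (snd \o GX); split=> i; have [] := GXP i.
Qed.

Section Decomposition.
Variables (G : set mon) (upG : upset G) (r : nat) (Q : 'I_r -> set S).
Hypothesis decQ : irredundant_primary_dec (mon_ideal G) Q.
Variables (Gs : 'I_r -> set mon) (Xs : 'I_r -> {set 'I_n}).
Hypothesis QE : forall i, Q i = mon_ideal (Gs i).
Hypothesis GX : forall i, primary_exps (Gs i) (Xs i).

Lemma dec_mem m : G m <-> forall i, Gs i m.
Proof.
have [_ e _ _] := decQ; rewrite -(mon_idealX K) e; split=> [Gm i|Gm i _].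
  by apply/(mon_idealX K); rewrite -QE; apply: Gm.
by rewrite QE; apply/mon_idealX.
Qed.

Lemma dec_vars_inj : injective Xs.
Proof.
move=> i j e; apply/eqP; apply: contrapT => /negP ij.
have [_ _ /(_ i j ij) nr _] := decQ; apply: nr.
by rewrite !QE (primary_exps_radical K (GX i)) (primary_exps_radical K (GX j)) e.
Qed.

(** Irredundancy gives a monomial lying in every component but the [i]-th. Among its multiples
    outside that component, one of maximal weight in [Xs i] is a witness; the weight is bounded by
    [weight_ge_mem]. *)
Lemma dec_vars_assoc i : Xs i \in assoc_primes G.
Proof.
apply/assoc_primesP.
have [w0 w0i w0j] : exists2 w, ~ Gs i w & forall j, j != i -> Gs j w.
  have [_ _ _ /(_ i)/existsNP[f /not_implyP[fQ]]] := decQ.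
  rewrite QE => /existsNP[w /not_implyP[wf Giw]]; exists w => // j ji.
  by have := fQ j ji; rewrite QE; apply.
have [upi _ _ /(uniform_exponent upi)[N GN]] := GX i.
pose A k := `[< exists2 m, ~ Gs i (w0 + m)%MM & var_weight (Xs i) (w0 + m)%MM = k >].
have exA : exists k, A k.
  by exists (var_weight (Xs i) w0); apply/asboolP; exists 0%MM; rewrite addm0.
have boundA k : A k -> (k <= #|Xs i| * N)%N.
  move/asboolP => [m Gm <-]; rewrite leqNgt; apply/negP.
  by move/(weight_ge_mem upi GN).
have [k /asboolP[m Gm wk] maxk] := ex_maxnP exA boundA.
exists (w0 + m)%MM; split.
  move=> j jX; apply/dec_mem => i'; have [->|ii'] := eqVneq i' i; last first.
    have [upi' _ _ _] := GX i'; rewrite -addmA; apply: upsetD => //.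
    exact: w0j.
  apply: contrapT => nG; suff : (k.+1 <= k)%N by rewrite ltnn.
  apply: maxk; apply/asboolP; exists (m + U_(j))%MM; rewrite addmA //.
  rewrite var_weightD wk -addn1; congr (_ + _)%N.
  rewrite /var_weight (bigD1 j) //= mnm1E eqxx big1 ?addn0 // => l /andP[_ /negPf lj].
  by rewrite mnm1E eq_sym lj.
move=> m' wm' /dec_mem/(_ i) Gi; apply: Gm.
by have [_ _ freei _] := GX i; apply: free_exps freei wm' Gi.
Qed.

(** Each component avoiding [x^w] has [Y] inside [Xs i]. If all these inclusions were strict, powers
    of variables outside [Y] would bring [x^w] into every component, contrary to the choice of
    [w]. *)
Lemma assoc_dec_vars Y : Y \in assoc_primes G -> exists i, Xs i = Y.
Proof.
move=> /assoc_primesP[w [wY wN]]; apply: contrapT => noi.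
have sub i : ~ Gs i w -> Y \subset Xs i.
  move=> nG; apply/fintype.subsetP => k kY; apply: contrapT => /negP kX.
  have [_ _ freeG _] := GX i; apply: nG; apply: freeG kX _.
  by have /dec_mem := wY k kY; apply.
have /choice[e eP] : forall i, exists m, var_weight Y m = 0%N /\ Gs i (w + m)%MM.
  move=> i; have [Gw|nGw] := pselect (Gs i w).
    by exists 0%MM; rewrite addm0; split=> //; rewrite /var_weight big1 // => j _;
      rewrite mnm0E.
  have [k kX kY] : exists2 k, k \in Xs i & k \notin Y.
    apply/fintype.subsetPn; apply: contrapT => /negP; rewrite negbK => sX.
    by apply: noi; exists i; apply/eqP; rewrite finset.eqEsubset sX sub.
  have [upi _ _ /(_ k kX)[N GN]] := GX i; exists (U_(k) *+ N)%MM; split.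
    rewrite /var_weight big1 // => j jY; rewrite mulmnE mnm1E.
    by case: (eqVneq k j) => [kj|]; rewrite ?mul0n //; rewrite kj jY in kY.
  by apply: upi GN _; apply: lem_addl.
apply: (wN (\sum_i e i)%MM).
  rewrite /var_weight big1 // => j jY; rewrite mnm_sumE big1 // => i _.
  have [/eqP] := eP i; rewrite /var_weight sum_nat_eq0 => /forall_inP/(_ j jY)/eqP //.
apply/dec_mem => i; have [_] := eP i; have [upi _ _ _] := GX i.
move/upi; apply; apply/mnm_lepP => j; rewrite !mnmDE leq_add2l mnm_sumE.
by rewrite (bigD1 i) //= leq_addr.
Qed.

Lemma ideal_sum_mon A :
  ideal_sum Q A = mon_ideal [set m | exists2 i, i \in A & Gs i m].
Proof.
apply/seteqP; split=> [_ [g gQ ->]|].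
  apply: ideal_sumP => [|i iA].
    apply: mon_ideal_is_ideal => m m' [i iA Gm] le; exists i => //.
    by have [upi _ _ _] := GX i; apply: upi le.
  by have := gQ i iA; rewrite QE => gG m /gG; exists i.
apply: mon_ideal_sub => [|m [i iA Gm]].
  have idQ i : is_ideal (Q i).
    by rewrite QE; apply: mon_ideal_is_ideal; have [] := GX i.
  split.
  - by exists (fun=> 0) => [j _|]; [have [] := idQ j | rewrite big1].
  - move=> _ _ [f fQ ->] [g gQ ->]; exists (fun j => f j + g j).
      by move=> j jA; have [_ D _] := idQ j; apply: D; [apply: fQ | apply: gQ].
    by rewrite big_split.
  - move=> a _ [f fQ ->]; exists (fun j => a * f j).
      by move=> j jA; have [_ _ M] := idQ j; apply/M/fQ.
    by rewrite mulr_sumr.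
exists (fun j => if j == i then 'X_[m] else 0).
  move=> j jA; case: eqP => [->|_]; rewrite QE; first exact/mon_idealX.
  by move=> ?; rewrite msupp0.
by rewrite -big_mkcondr /= (bigD1 i) ?iA ?eqxx //= big1 ?addr0 // => j;
  case/andP=> /andP[_ /eqP ->]; rewrite eqxx.
Qed.

Lemma radical_ideal_sum A :
  radical (ideal_sum Q A) = prime_vars (\bigcup_(i in A) Xs i)%SET.
Proof.
rewrite ideal_sum_mon; apply: radical_mon_ideal.
- move=> m m' [i iA Gm] le; exists i => //.
  by have [upi _ _ _] := GX i; apply: upi le.
- move=> m [i iA /(primary_exps_sub (GX i))[k kX mk]]; exists k => //.
  by apply/finset.bigcupP; exists i.
- move=> k /finset.bigcupP[i iA kX]; have [_ _ _ /(_ k kX)[N GN]] := GX i.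
  by exists N; exists i.
Qed.

(** The radical of a sum of components is generated by the union of their variable sets, and these
    sets are exactly the associated primes. *)
Lemma spans_radicalP A : spans_radical Q A <->
  (\bigcup_(i in A) Xs i)%SET = finset.cover (assoc_primes G).
Proof.
have -> : finset.cover (assoc_primes G) = (\bigcup_(i in [set: 'I_r]%SET) Xs i)%SET.
  apply/finset.setP => k; apply/finset.bigcupP/finset.bigcupP => -[].
    by move=> _ /assoc_dec_vars[i <-] kX; exists i; rewrite ?inE.
  by move=> i _ kX; exists (Xs i) => //; apply: dec_vars_assoc.
rewrite /spans_radical !radical_ideal_sum; split=> [/prime_vars_inj //|-> //].
Qed.

Lemma has_height_ideal_sum b :
  has_height (ideal_sum Q [set: 'I_r]%SET) b <-> b = #|finset.cover (assoc_primes G)|.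
Proof.
have /spans_radicalP <- : spans_radical Q [set: 'I_r]%SET by [].
apply: has_height_prime_vars => [f fJ|k].
  by rewrite -radical_ideal_sum; exists 1%N; rewrite expr1.
by move/(prime_varsX K); rewrite -radical_ideal_sum.
Qed.

End Decomposition.

Definition covering G (F : {set {set 'I_n}}) :=
  F \subset assoc_primes G /\ finset.cover F = finset.cover (assoc_primes G).

(** [Xs] is a bijection from the components to the associated primes, so the families of components
    in the size correspond to covering families of primes, whatever the decomposition. *)
Lemma has_sizeP G s : upset G -> has_size (mon_ideal G : set S) s ->
  exists a, [/\ s = (a + (n - #|finset.cover (assoc_primes G)|) - 1)%N,
    exists2 F, covering G F & #|F| = a & forall F, covering G F -> (a <= #|F|)%N].
Proof.
move=> upG [_ _ _ [r [Q [a [b [decQ [A AQ <-] mina hb ->]]]]]].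
have [Gs [Xs [QE GX]]] := dec_exps decQ.
have Xinj := dec_vars_inj decQ QE GX.
have Xas := dec_vars_assoc decQ QE GX.
move/(has_height_ideal_sum decQ QE GX): hb => ->.
exists #|A|; split=> //.
  exists (Xs @: A); last by rewrite card_imset.
  split; first by apply/fintype.subsetP => _ /imsetP[i _ ->]; apply: Xas.
  move/(spans_radicalP decQ QE GX): AQ => <-.
  by rewrite cover_imset.
move=> F [sF cF]; have -> : F = Xs @: (Xs @^-1: F).
  apply/finset.setP => Y; apply/idP/imsetP => [YF|[i]]; last by rewrite inE => ? ->.
  have [i e] := assoc_dec_vars decQ QE GX (fintype.subsetP sF Y YF).
  by exists i; rewrite ?inE e.
rewrite card_imset //; apply: mina; apply/(spans_radicalP decQ QE GX).
rewrite -cF; apply/finset.setP => k; apply/finset.bigcupP/finset.bigcupP => -[].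
  by move=> i; rewrite inE => iF kX; exists (Xs i).
move=> Y YF kY; have [i e] := assoc_dec_vars decQ QE GX (fintype.subsetP sF Y YF).
by exists i; rewrite ?inE e.
Qed.

(** * Existence of irredundant monomial primary decompositions *)

Section Existence.
Variables (G : set mon) (N : nat).
Hypothesis upG : upset G.
Hypothesis boundG : forall m, G m ->
  exists g : mon, [/\ G g, (g <= m)%MM & forall i, (g i <= N)%N].

(* Exponents of [(I : x_Y^oo) + (x_i^N, i in Y)], where [x_Y] is the product of
   the variables outside [Y]: the candidate [Y]-primary component. *)
Definition component Y : set mon := [set m | (exists2 i, i \in Y & (N <= m i)%N) \/
  G [multinom (if i \in Y then m i else m i + N)%N | i < n]].

Lemma upset_component Y : upset (component Y).
Proof.
move=> m m' cm /mnm_lepP le; case: cm => [[i iY Ni]|Gm].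
  by left; exists i => //; apply: leq_trans (le i).
right; apply: upG Gm _; apply/mnm_lepP => i; rewrite !mnmE.
by case: ifP => _ //; rewrite leq_add2r.
Qed.

(** Outside [Y] the shift by [N] already dominates the exponents of the generators given by
    [boundG], so further variables outside [Y] do not affect membership. *)
Lemma component_primary Y : ~ component Y 0%MM -> primary_exps (component Y) Y.
Proof.
move=> c0; split=> //; first exact: upset_component.
  move=> m i iY [[j jY]|].
    rewrite mnmDE mnm1E; case: (eqVneq i j) => [ij|_]; last first.
      by rewrite addn0 => Nj; left; exists j.
    by rewrite ij jY in iY.
  move/boundG => [g [Gg /mnm_lepP le gN]]; right; apply: upG Gg _.
  apply/mnm_lepP => j; have := le j; rewrite !mnmE.
  case: ifP => jY; last by move=> _; apply: leq_trans (gN j) _; apply: leq_addl.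
  case: (eqVneq i j) => [ij|_]; last by rewrite addn0.
  by rewrite ij jY in iY.
move=> i iY; exists N; left; exists i => //.
by rewrite mulmnE mnm1E eqxx mul1n.
Qed.

Lemma sub_component Y : G `<=` component Y.
Proof.
move=> m Gm; right; apply: upG Gm _; apply/mnm_lepP => i; rewrite mnmE.
by case: ifP => // _; apply: leq_addr.
Qed.

Lemma bigcap_component m : (forall Y, component Y m) -> G m.
Proof.
(* For this set the first alternative is impossible, and outside it the exponents of [m] are at
   least [N], so they dominate those of [g] even without the shift. *)
case/(_ [set i | (m i < N)%N]%SET) => [[i]|].
  by rewrite inE => lt; rewrite leqNgt lt.
move/boundG => [g [Gg /mnm_lepP le gN]]; apply: upG Gg _; apply/mnm_lepP => i.
have := le i; rewrite mnmE inE; case: ltnP => // Nm _.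
exact: leq_trans (gN i) Nm.
Qed.

(** A minimal family of sets [Y] whose components still intersect in [G] is irredundant. *)
Lemma ex_irredundant_primary_dec : exists r (Q : 'I_r -> set S),
  irredundant_primary_dec (mon_ideal G) Q.
Proof.
pose ok (F : {set {set 'I_n}}) :=
  `[< forall m, (forall Y, Y \in F -> component Y m) -> G m >].
have okT : ok [set: {set 'I_n}]%SET.
  by apply/asboolP => m Fm; apply: bigcap_component => Y; apply: Fm; rewrite inE.
have [F /minsetP[/asboolP okF minF] _] := minset_exists okT.
have red Y : Y \in F ->
    ~ (forall m, (forall Z, Z \in F -> Z != Y -> component Z m) -> component Y m).
  move=> YF sub; have okFY : ok (F :\ Y).
    apply/asboolP => m FYm; apply: okF => Z ZF.
    have [->|ZY] := eqVneq Z Y; last by apply: FYm; rewrite !inE ZY.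
    by apply: sub => Z' Z'F Z'Y; apply: FYm; rewrite !inE Z'Y.
  have /finset.setP/(_ Y) := minF _ okFY (subsetDl _ _).
  by rewrite !inE eqxx YF.
(* A component equal to the whole ring would be redundant, so every member of [F] is proper. *)
have prF Y : Y \in F -> primary_exps (component Y) Y.
  move=> YF; apply: component_primary => c0; apply: (red Y YF) => m _.
  by rewrite -[m]add0m; exact: upsetD (@upset_component Y) c0.
exists #|F|, (fun i => mon_ideal (component (enum_val i))); split.
- move=> i; have prYi := prF _ (enum_valP i); split; last exact: primary_exps_is_primary prYi.
  by apply/is_monomial_idealP; exists (component (enum_val i)) => //; have [] := prYi.
- apply/seteqP; split=> [f fG i _ m /fG /sub_component //|f fQ m mf].
  by apply: okF => Y YF; rewrite -(enum_rankK_in YF YF); exact: (fQ (enum_rank_in YF Y) I m mf).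
- move=> i j; apply: contraNnot.
  rewrite (primary_exps_radical K (prF _ (enum_valP i))).
  rewrite (primary_exps_radical K (prF _ (enum_valP j))).
  by move=> /prime_vars_inj/enum_val_inj ->.
- move=> i sub; apply: (red (enum_val i) (enum_valP i)) => m mF.
  apply/(mon_idealX K); apply: sub => j ji; apply/mon_idealX.
  by apply: mF; rewrite ?enum_valP // (inj_eq enum_val_inj).
Qed.

Lemma ex_has_size : (exists m, G m) -> ~ G 0%MM ->
  exists s, has_size (mon_ideal G : set S) s.
Proof.
move=> [m0 Gm0] G0; have [r [Q decQ]] := ex_irredundant_primary_dec.
have [Gs [Xs [QE GX]]] := dec_exps decQ.
have ex : exists k, `[< exists2 A, spans_radical Q A & #|A| = k >].
  by exists #|[set: 'I_r]%SET|; apply/asboolP; exists [set: 'I_r]%SET.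
case: (ex_minnP ex) => a /asboolP[A spA cA] mina.
exists (a + (n - #|finset.cover (assoc_primes G)|) - 1)%N; split.
- by apply/is_monomial_idealP; exists G.
- move=> e; have : (mon_ideal G : set S) 'X_[m0] by apply/mon_idealX.
  rewrite e => /eqP; rewrite -msupp_eq0 msuppX //.
- by move=> /(_ 0%MM); rewrite msupp1 mem_seq1 => /(_ (eqxx _)).
exists r, Q, a, #|finset.cover (assoc_primes G)|; split=> //.
- by exists A.
- by move=> B spB; apply: mina; apply/asboolP; exists B.
- exact/(has_height_ideal_sum decQ QE GX).
Qed.

End Existence.

End AssociatedPrimes.

(** * Koszul complex and regular sequences *)

Section KoszulComplex.
Variables (R : comNzRingType) (n : nat) (x : 'I_n -> R).
Implicit Types (A W : {set 'I_n}) (phi psi : {set 'I_n} -> R) (c : 'I_n -> R).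

Definition ksign (i : 'I_n) A : R := (-1) ^+ #|[set j in A | (j < i)%N]%SET|.

Lemma ksign_setD1 i k A : i \in A ->
  ksign k (A :\ i) = (-1) ^+ (i < k)%N * ksign k A.
Proof.
move=> iA; rewrite /ksign; case: (ltnP i k) => ik.
  rewrite [in RHS](cardsD1 i) !inE iA ik /= exprD !expr1 mulrA mulrNN !mul1r.
  congr (_ ^+ #|pred_of_set _|); apply/finset.setP => j; rewrite !inE.
  by rewrite andbA.
rewrite mul1r; congr (_ ^+ #|pred_of_set _|); apply/finset.setP => j; rewrite !inE.
by case: (eqVneq j i) => //= ->; rewrite ltnNge ik andbF.
Qed.

Lemma ksign_setU1 i k A : i \notin A ->
  ksign k (i |: A) = (-1) ^+ (i < k)%N * ksign k A.
Proof.
move=> iA; have := @ksign_setD1 i k (i |: A); rewrite finset.setU11 finset.setU1K // => -> //.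
by rewrite mulrA -signr_addb addbb mul1r.
Qed.

Lemma ksign_sqr i A : ksign i A * ksign i A = 1.
Proof. by rewrite -expr2 sqrr_sign. Qed.

(** Koszul cochains of all degrees at once: the value at [A] is the coefficient of the exterior
    monomial of [A], and [kdiff] is exterior multiplication by the sum of the [x i e_i]. *)
Definition kdiff phi A := \sum_(i in A) ksign i A * x i * phi (A :\ i).

(** Contraction with the linear form sending [e_i] to [c i]. *)
Definition kcontract c phi A := \sum_(i | i \notin A) ksign i A * c i * phi (i |: A).

(** The terms with [i < j] cancel those with [j < i], without any division by 2. *)
Lemma sum_antisym A (F : 'I_n -> 'I_n -> R) :
  (forall i j, i \in A -> j \in A -> i != j -> F i j = - F j i) ->
  \sum_(i in A) \sum_(j in A :\ i) F i j = 0.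
Proof.
move=> antiF.
transitivity (\sum_(i in A) \sum_(j in A | (i < j)%N) F i j +
              \sum_(i in A) \sum_(j in A | (j < i)%N) F i j).
  rewrite -big_split; apply: eq_bigr => i iA /=.
  rewrite (bigID (fun j : 'I_n => (i < j)%N)) /=; congr (_ + _).
    apply: eq_bigl => j; rewrite !inE.
    by case: (eqVneq j i) => [->|_] /=; rewrite ?ltnn ?andbF.
  apply: eq_bigl => j; rewrite !inE -leqNgt.
  case: (eqVneq j i) => [->|ji] /=; first by rewrite ltnn andbF.
  by rewrite [in RHS]ltn_neqAle val_eqE ji.
rewrite [X in _ + X](exchange_big_dep (mem A)) /=; last by move=> i j _ /andP[].
rewrite -big_split big1 // => i iA /=.
rewrite [X in _ + X](eq_bigl (fun j : 'I_n => (j \in A) && (i < j)%N));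
  last by move=> j; rewrite iA.
rewrite -big_split big1 // => j /andP[jA ij] /=.
by rewrite antiF // ?addNr // -val_eqE neq_ltn ij.
Qed.

Lemma kdiff_kdiff phi A : kdiff (kdiff phi) A = 0.
Proof.
rewrite /kdiff.
transitivity (\sum_(i in A) \sum_(j in A :\ i)
  ksign i A * ksign j (A :\ i) * (x i * x j) * phi (A :\ i :\ j)).
  by apply: eq_bigr => i iA; rewrite mulr_sumr; apply: eq_bigr => j _; ring.
apply: sum_antisym => i j iA jA ij.
rewrite !ksign_setD1 // [A :\ j :\ i]finset.setDDl [([set j] :|: _)%SET]finset.setUC -finset.setDDl.
have [ltij|leji] := ltnP i j; first by rewrite (ltnNge j) ltnW //=; ring.
have -> : (j < i)%N by rewrite ltn_neqAle leji andbT eq_sym.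
by rewrite /=; ring.
Qed.

(** The diagonal terms give [c i * x i] for [i] in [A] from the first summand and for [i] outside
    [A] from the second. Hence the sum of the [c i * x i] acts as zero on cohomology. *)
Lemma koszul_homotopy c phi A :
  kdiff (kcontract c phi) A + kcontract c (kdiff phi) A =
  (\sum_i c i * x i) * phi A.
Proof.
rewrite (bigID (mem A)) /= mulrDl /kdiff /kcontract.
(* The off-diagonal term, removing [i] and adding [k]; it arises from both composites with opposite
   signs. *)
pose T i k := ksign i A * ksign k A * (-1) ^+ (i < k)%N * (x i * c k) * phi (k |: (A :\ i)).
have -> : \sum_(i in A) ksign i A * x i *
    (\sum_(k | k \notin A :\ i) ksign k (A :\ i) * c k * phi (k |: A :\ i)) =
    (\sum_(i in A) c i * x i) * phi A +
    \sum_(i in A) \sum_(k | k \notin A) T i k.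
  rewrite mulr_suml -big_split; apply: eq_bigr => i iA /=.
  rewrite (bigD1 i) /=; last by rewrite !inE eqxx.
  rewrite mulrDr finset.setD1K // ksign_setD1 // ltnn mul1r; congr (_ + _).
    by rewrite -[RHS]mul1r -(ksign_sqr i A); ring.
  rewrite mulr_sumr; apply: eq_big => k.
    rewrite !inE negb_and negbK; case: (eqVneq k i) => [->|_] /=; first by rewrite iA.
    by rewrite andbT.
  by move=> _; rewrite ksign_setD1 // /T; ring.
have -> : \sum_(k | k \notin A) ksign k A * c k *
    (\sum_(i in k |: A) ksign i (k |: A) * x i * phi ((k |: A) :\ i)) =
    (\sum_(k | k \notin A) c k * x k) * phi A -
    \sum_(k | k \notin A) \sum_(i in A) T i k.
  rewrite mulr_suml -sumrB; apply: eq_bigr => k kA /=.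
  rewrite (bigD1 k) ?finset.setU11 //= finset.setU1K // ksign_setU1 // ltnn mul1r mulrDr.
  congr (_ + _); first by rewrite -[RHS]mul1r -(ksign_sqr k A); ring.
  rewrite mulr_sumr -sumrN; apply: eq_big => i.
    by rewrite !inE; case: (eqVneq i k) => [->|_] /=; rewrite ?(negPf kA) ?andbT.
  rewrite !inE => /andP[/orP[->//|iA] ik]; rewrite ksign_setU1 // /T.
  have -> : (k |: A) :\ i = k |: (A :\ i).
    by apply/finset.setP => j; rewrite !inE; case: (eqVneq j k) => [->|] //=; rewrite eq_sym ik.
  have [ltik|leki] := ltnP i k; first by rewrite (ltnNge k) ltnW //=; ring.
  have -> : (k < i)%N by rewrite ltn_neqAle leki andbT eq_sym.
  by rewrite /=; ring.
by rewrite [X in _ + X + _]exchange_big /=; ring.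
Qed.

End KoszulComplex.

(** * Regular sequences and vanishing of Koszul cohomology *)

Section RegularSequences.
Variable R : comNzRingType.
Implicit Types (N : set R) (fs : seq R).

Definition seq_smul fs N : set R :=
  ideal_smul (ideal_gen [set` fs]) (N : set R^o).

Lemma seq_smulP fs N y : is_ideal N ->
  seq_smul fs N y <-> exists2 g : nat -> R, forall i, N (g i) &
    y = \sum_(i < size fs) fs`_i * g i.
Proof.
case=> N0 ND NM; split.
  pose M : set R := [set y | exists2 g : nat -> R, forall i, N (g i) &
    y = \sum_(i < size fs) fs`_i * g i].
  have M0 : M 0.
    by exists (fun=> 0) => //; rewrite big1 // => i _; rewrite mulr0.
  have MD a b : M a -> M b -> M (a + b).
    move=> [g gN ->] [h hN ->]; exists (fun i => g i + h i) => [i|]; first exact: ND.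
    by rewrite -big_split; apply: eq_bigr => i _; rewrite mulrDr.
  have MM a b : M b -> M (a * b).
    move=> [g gN ->]; exists (fun i => a * g i) => [i|]; first exact: NM.
    by rewrite mulr_sumr; apply: eq_bigr => i _; rewrite mulrCA.
  suff sub : seq_smul fs N `<=` M by exact: (sub y).
  apply: smallest_sub => [|_ [a ga [z Nz <-]]]; first by split.
  (* For fixed [z], the multipliers sending [z] into [M] form an ideal, which contains [fs]. *)
  have Mz : [set b | M (b * z)] a; last exact: Mz.
  apply: ga; split.
    split=> /= [|f g fM gM|b f fM]; first by rewrite mul0r.
      by rewrite mulrDl; apply: MD.
    by rewrite -mulrA; apply: MM.
  move=> f /= /(nthP 0)[i isz <-].
  exists (fun j => if j == i then z else 0) => [j|]; first by case: ifP.
  rewrite (bigD1 (Ordinal isz)) //= eqxx big1 ?addr0 // => j.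
  by rewrite -val_eqE /= => /negPf ->; rewrite mulr0.
case=> g gN -> M [[M0 MD MM] sM].
elim/big_ind: _ => [//||i _]; first exact: MD.
apply: sM; exists fs`_i.
  by move=> J [_ sJ]; apply: sJ; apply: mem_nth.
by exists (g i).
Qed.

Lemma seq_smul_ideal fs N : is_ideal N -> is_ideal (seq_smul fs N).
Proof.
move=> idN; have [N0 ND NM] := idN; split.
- apply/(seq_smulP _ _ idN); exists (fun=> 0) => //.
  by rewrite big1 // => i _; rewrite mulr0.
- move=> _ _ /(seq_smulP _ _ idN)[g gN ->] /(seq_smulP _ _ idN)[h hN ->].
  apply/(seq_smulP _ _ idN); exists (fun i => g i + h i) => [i|]; first exact: ND.
  by rewrite -big_split; apply: eq_bigr => i _; rewrite mulrDr.
- move=> a _ /(seq_smulP _ _ idN)[g gN ->].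
  apply/(seq_smulP _ _ idN); exists (fun i => a * g i) => [i|]; first exact: NM.
  by rewrite mulr_sumr; apply: eq_bigr => i _; rewrite mulrCA.
Qed.

Lemma seq_smul0 N y : is_ideal N -> seq_smul [::] N y -> y = 0.
Proof. by move=> idN /(seq_smulP _ _ idN)[g _ ->]; rewrite big_ord0. Qed.

Lemma seq_smul_rcons fs f N y : is_ideal N ->
  seq_smul (rcons fs f) N y <->
  exists b z, [/\ seq_smul fs N b, N z & y = b + f * z].
Proof.
move=> idN; have [N0 ND NM] := idN; split.
  move/(seq_smulP _ _ idN)=> [g gN ->].
  rewrite size_rcons big_ord_recr /= nth_rcons ltnn eqxx.
  eexists; exists (g (size fs)); split=> //; apply/(seq_smulP _ _ idN).
  by exists g => //; apply: eq_bigr => i _; rewrite nth_rcons ltn_ord.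
move=> [b [z [/(seq_smulP _ _ idN)[g gN ->] Nz ->]]]; apply/(seq_smulP _ _ idN).
exists (fun i => if i == size fs then z else g i) => [i|]; first by case: ifP.
rewrite size_rcons big_ord_recr /= nth_rcons ltnn !eqxx; congr (_ + _).
by apply: eq_bigr => i _; rewrite nth_rcons ltn_ord ltn_eqF.
Qed.

Lemma regular_seqP N fs : regular_seq (N : set R^o) fs <->
  (forall i, (i < size fs)%N -> forall y, N y ->
     seq_smul (take i fs) N (fs`_i * y) -> seq_smul (take i fs) N y) /\
  ~ (N `<=` seq_smul fs N).
Proof. by []. Qed.

Section KoszulVanishing.
Variables (n : nat) (x : 'I_n -> R).
Implicit Types (A : {set 'I_n}) (phi psi : {set 'I_n} -> R).

(* The Koszul cohomology of [N / B] vanishes below degree [r]. *)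
Definition koszul_vanish r (B N : set R) := forall i, (i < r)%N ->
  forall phi : {set 'I_n} -> R, (forall A, N (phi A)) ->
  (forall A, #|A| = i.+1 -> B (kdiff x phi A)) ->
  exists2 psi, forall A, N (psi A) & forall A, #|A| = i -> B (phi A - kdiff x psi A).

Lemma kdiff_ideal N phi A : is_ideal N -> (forall A, N (phi A)) -> N (kdiff x phi A).
Proof.
by move=> idN phiN; apply: ideal_sumP => // i _; case: idN => _ _; apply.
Qed.

(* A class [phi] in degree [i] is killed by [f], so [f phi = d psi]; modulo [f],
   [psi] is a cocycle of degree [i - 1], hence [psi = d chi + f eta], so that
   [f (phi - d eta) = 0] and [phi = d eta]. *)
Lemma regular_koszul_vanish N fs0 fs : is_ideal N ->
  (forall f, f \in fs -> exists c, f = \sum_i c i * x i) ->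
  (forall i, (i < size fs)%N -> forall y, N y ->
     seq_smul (fs0 ++ take i fs) N (fs`_i * y) -> seq_smul (fs0 ++ take i fs) N y) ->
  koszul_vanish (size fs) (seq_smul fs0 N) N.
Proof.
move=> idN; have [N0 ND NM] := idN; elim: fs fs0 => [//|f fs IH] fs0 fsx reg.
have idB := seq_smul_ideal fs0 idN; have [B0 BD BM] := idB.
have regf y : N y -> seq_smul fs0 N (f * y) -> seq_smul fs0 N y.
  by have := reg 0%N isT y; rewrite take0 cats0.
have {reg IH}IH : koszul_vanish (size fs) (seq_smul (rcons fs0 f) N) N.
  apply: IH => [g gfs|i ifs y Ny]; first by apply: fsx; rewrite inE gfs orbT.
  by have := reg i.+1 ifs y Ny; rewrite /= cat_rcons.
have [c ef] := fsx f (mem_head _ _).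
move=> i ir phi phiN dphi.
pose psi := kcontract c phi.
have psiN A : N (psi A) by apply: ideal_sumP => // j _; apply: NM.
have dpsi A : #|A| = i -> seq_smul fs0 N (f * phi A - kdiff x psi A).
  move=> cA; rewrite ef -koszul_homotopy -/psi addrAC subrr add0r.
  apply: ideal_sumP => // j jA; apply: BM; apply: dphi.
  by rewrite cardsU1 jA cA.
(* In degree 0 the differential of [psi] vanishes at the empty set, so regularity of [f] applies
   directly. *)
case: i ir dphi dpsi => [|i] ir dphi dpsi.
  exists (fun=> 0) => [//|A A0].
  have -> : kdiff x (fun=> 0) A = 0 by rewrite /kdiff big1 // => j _; rewrite mulr0.
  rewrite subr0; apply: regf => //; move: (dpsi A A0).
  by rewrite (cards0_eq A0) /kdiff big_set0 subr0.
have [|chi chiN psi_chi] := IH i ir psi psiN.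
  move=> A cA; apply/seq_smul_rcons => //.
  exists (- (f * phi A - kdiff x psi A)), (phi A); split=> //; last by ring.
  by rewrite -mulN1r; apply: BM; apply: dpsi.
(* [e] is the cochain eta; only its values in degree [i] matter, and it is set to 0 in the
   others. *)
have /choice[e eP] : forall A, exists y, N y /\
    (#|A| = i -> seq_smul fs0 N (psi A - kdiff x chi A - f * y)).
  move=> A; have [cA|cA] := eqVneq #|A| i; last first.
    by exists 0; split=> // e; rewrite e eqxx in cA.
  have /(seq_smul_rcons _ _ _ idN)[b [y [Bb Ny e]]] := psi_chi A cA.
  by exists y; split=> // _; rewrite e addrK.
exists e => [A|A cA]; first by have [] := eP A.
apply: regf.
  rewrite -mulN1r; apply: ND => //; apply: NM; apply: kdiff_ideal => // A'.
  by have [] := eP A'.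
have -> : f * (phi A - kdiff x e A) = (f * phi A - kdiff x psi A) +
    kdiff x (fun A' => psi A' - kdiff x chi A' - f * e A') A.
  have -> : kdiff x (fun A' => psi A' - kdiff x chi A' - f * e A') A =
     kdiff x psi A - kdiff x (kdiff x chi) A - f * kdiff x e A.
    rewrite /kdiff mulr_sumr -!sumrB; apply: eq_bigr => j _; ring.
  by rewrite kdiff_kdiff; ring.
apply: BD; first exact: dpsi.
apply: ideal_sumP => // j jA; apply: BM; have [_] := eP (A :\ j); apply.
by move: cA; rewrite (cardsD1 j) jA => -[].
Qed.

(** A nonzero cohomology class in degree [r] contradicts the vanishing given by a longer regular
    sequence, applied with [fs0] empty. *)
Lemma regular_seq_size_le N r phi fs : is_ideal N ->
  (forall A, N (phi A)) -> (forall A, #|A| = r.+1 -> kdiff x phi A = 0) ->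
  (forall psi, (forall A, N (psi A)) ->
     exists2 A : {set 'I_n}, #|A| = r & phi A != kdiff x psi A) ->
  (forall f, f \in fs -> exists c, f = \sum_i c i * x i) ->
  regular_seq (N : set R^o) fs -> (size fs <= r)%N.
Proof.
move=> idN phiN dphi phi0 fsx [reg _]; rewrite leqNgt; apply/negP => rfs.
have := @regular_koszul_vanish N [::] fs idN fsx reg r rfs phi phiN.
case=> [A cA|psi psiN e]; first by rewrite dphi //; case: (seq_smul_ideal [::] idN).
have [A cA /eqP] := phi0 psi psiN; apply.
by apply/eqP; rewrite -subr_eq0; apply/eqP; exact: (seq_smul0 idN (e A cA)).
Qed.

End KoszulVanishing.

(** Multiplication by [c] is an isomorphism of modules from [N] onto its image. *)
Lemma regular_seq_mul (c : R) N fs : GRing.lreg c -> is_ideal N ->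
  regular_seq ([set c * y | y in N] : set R^o) fs <-> regular_seq (N : set R^o) fs.
Proof.
move=> regc idN; have [N0 ND NM] := idN; set cN := [set c * y | y in N].
have idcN : is_ideal cN.
  split; first by exists 0; rewrite ?mulr0.
    by move=> _ _ [y Ny <-] [z Nz <-]; exists (y + z); rewrite ?mulrDr //; apply: ND.
  by move=> a _ [y Ny <-]; exists (a * y); rewrite 1?mulrCA //; apply: NM.
have smulE gs y : seq_smul gs cN (c * y) <-> seq_smul gs N y.
  split=> [/(seq_smulP _ _ idcN)[g gN e]|/(seq_smulP _ _ idN)[g gN ->]].
    have /choice[h hP] : forall i, exists z, N z /\ c * z = g i.
      by move=> i; have [z Nz ez] := gN i; exists z.
    apply/(seq_smulP _ _ idN); exists h => [i|]; first by have [] := hP i.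
    apply: regc; rewrite e mulr_sumr; apply: eq_bigr => i _.
    by have [_ <-] := hP i; rewrite mulrCA.
  apply/(seq_smulP _ _ idcN); exists (fun i => c * g i) => [i|]; first by exists (g i).
  by rewrite mulr_sumr; apply: eq_bigr => i _; rewrite mulrCA.
rewrite !regular_seqP; split=> -[reg nsub]; split.
- move=> i ifs y Ny h; apply/smulE; apply: reg => //; first by exists y.
  by rewrite mulrCA; apply/smulE.
- by move=> sub; apply: nsub => _ [y Ny <-]; apply/smulE; apply: sub.
- move=> i ifs _ [y Ny <-]; rewrite mulrCA => /smulE h; apply/smulE.
  exact: reg.
- by move=> sub; apply: nsub => y Ny; apply/smulE; apply: sub; exists y.
Qed.

End RegularSequences.

(** * Bounds on the lengths of regular sequences *)

Section DepthOfMonomialIdeals.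
Variables (K : fieldType) (n : nat).
Local Notation S := {mpoly K[n]}.
Local Notation mon := 'X_{1..n}.
Implicit Types (G H : set mon) (m w t : mon) (f : S) (X E : {set 'I_n}).

Lemma max_idealP f : max_ideal f -> exists c : 'I_n -> S, f = \sum_i c i * 'X_i.
Proof.
pose M : set S := [set f | exists c : 'I_n -> S, f = \sum_i c i * 'X_i].
suff sub : @max_ideal K n `<=` M by exact: (sub f).
apply: smallest_sub => [|_ [i _ <-]].
  split.
  - by exists (fun=> 0); rewrite big1 // => i _; rewrite mul0r.
  - move=> _ _ [c ->] [d ->]; exists (fun i => c i + d i).
    by rewrite -big_split; apply: eq_bigr => i _; rewrite mulrDl.
  - move=> a _ [c ->]; exists (fun i => a * c i).
    by rewrite mulr_sumr; apply: eq_bigr => i _; rewrite mulrA.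
exists (fun j => if j == i then 1 else 0).
rewrite (bigD1 i) //= eqxx mul1r big1 ?addr0 // => j /negPf ->.
by rewrite mul0r.
Qed.

Lemma mcoeffXM i f m :
  ('X_i * f)@_m = if m i == 0%N then 0 else f@_(m - U_(i))%MM.
Proof.
case: eqP => [mi|/eqP mi].
  apply: memN_msupp_eq0; apply/negP => /msuppM_le/allpairsP[[m1 m2] /= [+ _ e]].
  by rewrite msuppX mem_seq1 => /eqP e1; move: mi; rewrite e e1 mnmDE mnm1E eqxx.
have {1}-> : m = (U_(i) + (m - U_(i)))%MM by rewrite addmC submK // lep1mP.
by rewrite mulrC mcoeffMX.
Qed.

(* The cochain supported at [~: X :|: E] with value [x^w] has its differential
   in [mon_ideal H]; comparing coefficients of [x_q x^w] shows that it is not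
   the differential of a cochain with values in [mon_ideal H]. *)
Lemma regular_seq_socle_le H X E q w fs :
    upset H -> E \subset X -> q \in X :\: E -> var_weight (~: X) w = 0%N -> ~ H w ->
    (forall i, i \in X :\: E -> H (w + U_(i))%MM) ->
    (forall e t, e \in E -> w = (t + U_(e))%MM -> ~ H (t + U_(q))%MM) ->
    [set` fs] `<=` @max_ideal K n ->
    regular_seq (mon_ideal H : set (S^o)) fs ->
  (size fs <= (#|~: X| + #|E|).+1)%N.
Proof.
move=> upH sEX qXE wX Hw wH wE fsm.
have idH := mon_ideal_is_ideal K upH; have [_ _ HM] := idH.
pose W := ~: X :|: E; pose x := (fun i => 'X_i) : 'I_n -> S.
have cW : #|W| = (#|~: X| + #|E|)%N.
  rewrite /W cardsU (_ : _ :&: E = finset.set0) ?cards0 ?subn0 //.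
  apply/eqP; rewrite setI_eq0 disjoint_sym finset.disjoints_subset finset.setCK //.
have qW : q \notin W by move: qXE; rewrite !inE => /andP[/negPf -> ->].
pose omega := fun A : {set 'I_n} => if A == W then 'X_[w] else 0 : S.
rewrite -cW; apply: (@regular_seq_size_le _ _ x _ _ (kdiff x omega)) => //.
- move=> A; apply: ideal_sumP => // i iA; rewrite /omega.
  case: eqP => [e|_]; last by rewrite mulr0; case: idH.
  rewrite -mulrA; apply: HM; rewrite /x -mpolyXD addmC; apply/mon_idealX/wH.
  have : i \notin W by rewrite -e !inE eqxx.
  by rewrite !inE negb_or negbK andbC.
- by move=> A _; apply: kdiff_kdiff.
- move=> psi psiH; exists (q |: W); first by rewrite cardsU1 qW.
  apply/eqP => /(congr1 (mcoeff (w + U_(q))%MM)).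
  have signE i A f m : (ksign _ i A * x i * f)@_m =
      (-1) ^+ #|[set j in A | (j < i)%N]%SET| * ('X_i * f)@_m :> K.
    by rewrite -mulrA /ksign -(rmorph_sign (@mpolyC n K)) mul_mpolyC mcoeffZ.
  have wq : (w + U_(q))%MM q != 0%N by rewrite mnmDE mnm1E eqxx addn1.
  have -> : (kdiff x omega (q |: W))@_(w + U_(q)) =
      (-1) ^+ #|[set j in q |: W | (j < q)%N]%SET|.
    rewrite /kdiff (bigD1 q) ?finset.setU11 //= finset.setU1K // mcoeffD signE mcoeffXM.
    rewrite (negPf wq) addmK /omega eqxx mcoeffX eqxx mulr1.
    rewrite big1 ?mcoeff0 ?addr0 // => i /andP[iqW iq].
    case: eqP => [e|_]; last by rewrite mulr0.
    by move: qW; rewrite -e !inE eq_sym iq eqxx.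
  (* A contribution from [i = q] would put [w] in [H]; for [i] outside [X] the monomial is not
     divisible by [x_i]; for [i] in [E] it is excluded by [wE]. *)
  have -> : (kdiff x psi (q |: W))@_(w + U_(q)) = 0.
    rewrite /kdiff raddf_sum /= big1 // => i iqW.
    rewrite signE mcoeffXM; case: ifP => wi; first by rewrite mulr0.
    rewrite memN_msupp_eq0 ?mulr0 //; apply/negP => /(psiH _).
    move: iqW; rewrite !inE; case: (eqVneq i q) => [->|iq] /=.
      by rewrite addmK.
    have qi : (q == i) = false by rewrite eq_sym; apply: negPf.
    case/orP=> [iX|iE].
      move: wX wi; rewrite /var_weight => /eqP; rewrite sum_nat_eq0.
      move=> /forall_inP/(_ i); rewrite inE => /(_ iX)/eqP w0.
      by rewrite mnmDE mnm1E w0 qi.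
    have wi0 : w i != 0%N.
      by move: wi; rewrite mnmDE mnm1E qi addn0 => ->.
    have ew : w = (w - U_(i) + U_(i))%MM by rewrite submK // lep1mP.
    have -> : (w + U_(q) - U_(i) = w - U_(i) + U_(q))%MM.
      by rewrite {1}ew -addmA (addmC U_(i)%MM) addmA addmK.
    exact: wE iE ew.
  by move/eqP; rewrite signr_eq0.
- by move=> f /fsm/max_idealP.
Qed.

(** In top degree [n] the constant cochain 1 is a cocycle, while differentials take values in the
    maximal ideal. *)
Lemma regular_seq_unit_le fs :
  [set` fs] `<=` @max_ideal K n ->
  regular_seq ([set: S] : set (S^o)) fs -> (size fs <= n)%N.
Proof.
move=> fsm; have idT : is_ideal [set: S] by [].
pose x := (fun i => 'X_i) : 'I_n -> S.
pose phi := fun A : {set 'I_n} => 1 : S.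
apply: (@regular_seq_size_le _ _ x _ _ phi) => //.
- by move=> A cA; have := max_card A; rewrite cA card_ord ltnn.
- move=> psi _; exists [set: 'I_n]%SET; first by rewrite cardsT card_ord.
  apply/eqP => /(congr1 (mcoeff 0%MM)); rewrite /phi mcoeff1 eqxx.
  rewrite /kdiff raddf_sum /= big1 => [/eqP|i _]; first by rewrite oner_eq0.
  by rewrite -mulrA mulrCA mcoeffXM mnm0E eqxx.
- by move=> f /fsm/max_idealP.
Qed.

(** If [x_z x^m = x_y x^h] with [m], [h] in [H] and [y != z], then [t = m - U_(y)] satisfies both
    premises of the pairwise condition, so [m] is [x_y] times an element of [H]. *)
Lemma regular_vars H (zs : seq 'I_n) : upset H -> (exists m, H m) -> uniq zs ->
  pairwise (fun y z => `[< forall t, H (t + U_(y))%MM -> H (t + U_(z))%MM -> H t >]) zs ->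
  regular_seq (mon_ideal H : set (S^o)) [seq 'X_z | z <- zs].
Proof.
move=> upH [m0 Hm0] uzs /(pairwiseP _) pw.
have idH := mon_ideal_is_ideal K upH.
pose M (ys : seq 'I_n) : set mon :=
  [set m | exists2 y, y \in ys & exists2 h, H h & m = (h + U_(y))%MM].
have upM ys : upset (M ys).
  move=> m m' [y yys [h Hh ->]] le; exists y => //; exists (m' - U_(y))%MM.
    apply: upH Hh _; apply/mnm_lepP => i; rewrite mnmBE.
    by have /mnm_lepP/(_ i) := le; rewrite mnmDE; lia.
  by rewrite submK //; apply: lepm_trans le; apply: lem_addl.
have smulE ys : seq_smul [seq 'X_z | z <- ys] (mon_ideal H : set S) = mon_ideal (M ys).
  apply/seteqP; split=> [f /(seq_smulP _ _ idH)[g gH ->]|].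
    apply: ideal_sumP; first exact: mon_ideal_is_ideal.
    move=> [i iys] _ m /msuppM_le/allpairsP[[m1 m2] /= [+ /gH Hm2 ->]].
    rewrite size_map in iys; case: ys iys => [//|y0 ys] iys.
    rewrite (nth_map y0) // msuppX mem_seq1 => /eqP ->.
    exists (nth y0 (y0 :: ys) i); first exact: mem_nth.
    by exists m2 => //; rewrite addmC.
  apply: mon_ideal_sub; first exact: seq_smul_ideal.
  move=> _ [y yys [h Hh ->]]; rewrite addmC mpolyXD; apply/(seq_smulP _ _ idH).
  exists (fun j => if j == index y ys then 'X_[h] else 0) => [j|].
    by case: ifP => _; [apply/mon_idealX | case: idH].
  have isz : (index y ys < size [seq ('X_z : S) | z <- ys])%N.
    by rewrite size_map index_mem.
  rewrite (bigD1 (Ordinal isz)) //= eqxx big1 ?addr0 => [|j].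
    by rewrite (nth_map y) ?index_mem // nth_index.
  by rewrite -val_eqE /= => /negPf ->; rewrite mulr0.
apply/regular_seqP; split; last first.
  (* Otherwise every element of [H] would be a variable times an element of [H] of smaller degree,
     an infinite descent. *)
  rewrite smulE => /mon_ideal_subset sub.
  suff H0 k m : mdeg m = k -> H m -> False by apply: (H0 _ m0 erefl).
  elim: k m => [|k IHk] m dm /sub[y _ [h Hh e]].
    by move: dm; rewrite e mdegD mdeg1 addn1.
  by apply: (IHk h) => //; move: dm; rewrite e mdegD mdeg1 addn1 => -[].
move=> i; rewrite size_map => izs f fH.
rewrite -map_take smulE => zfM m mf.
have z0 : 'I_n by case: (zs) izs.
rewrite (nth_map z0) // in zfM.
set z := nth z0 zs i in zfM.
have [y yzs [h Hh e]] : M (take i zs) (U_(z) + m)%MM.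
  by apply: zfM; rewrite mcoeff_msupp mulrC mcoeffMX -mcoeff_msupp.
have [j [jz jlt]] : exists j, y = nth z0 zs j /\ (j < i)%N.
  exists (index y (take i zs)); split.
    by rewrite -[LHS](nth_index z0 yzs) nth_take // -[X in (_ < X)%N](size_takel (ltnW izs)) index_mem.
  by rewrite -[X in (_ < X)%N](size_takel (ltnW izs)) index_mem.
have yz : y != z.
  by rewrite jz /z nth_uniq ?(ltn_eqF jlt) // (ltn_trans jlt).
have my : m y != 0%N.
  apply/negP => /eqP my; move/mnmP/(_ y): e.
  by rewrite !mnmDE !mnm1E my eqxx eq_sym (negPf yz) /= !addnS.
have em : m = (m - U_(y) + U_(y))%MM by rewrite submK // lep1mP.
exists y => //; exists (m - U_(y))%MM => //.
have eh : h = (m - U_(y) + U_(z))%MM.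
  by apply: (@addIm _ U_(y)%MM); rewrite -e -addmA (addmC U_(z)%MM U_(y)%MM) addmA -em addmC.
have /asboolP := pw z0 j i (ltn_trans jlt izs) izs jlt.
by rewrite -jz; apply; rewrite -?em -?eh //; apply: fH.
Qed.

End DepthOfMonomialIdeals.

(** * Depth and size of monomial multiples *)

Section ShiftedMonomialIdeals.
Variables (K : fieldType) (n : nat).
Local Notation S := {mpoly K[n]}.
Local Notation mon := 'X_{1..n}.
Implicit Types (m w t : mon) (f : S) (Y : {set 'I_n}) (F : {set {set 'I_n}}).

Definition shift (mu : mon) (H : set mon) : set mon :=
  [set m | (mu <= m)%MM /\ H (m - mu)%MM].

Lemma shiftP mu H m : shift mu H m <-> exists2 h, H h & m = (mu + h)%MM.
Proof.
split=> [[le Hm]|[h Hh ->]]; last by split; rewrite ?lem_addr // addmC addmK.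
by exists (m - mu)%MM; rewrite // addmC submK.
Qed.

Lemma shiftD mu H h : shift mu H (mu + h)%MM <-> H h.
Proof. by split=> [[_]|Hh]; [rewrite addmC addmK | apply/shiftP; exists h]. Qed.

Lemma mon_ideal_shift mu H : upset H ->
  mon_ideal (shift mu H) = [set 'X_[mu] * f | f in mon_ideal H] :> set S.
Proof.
move=> upH; apply/seteqP; split=> [|_ [f fH <-] m].
  apply: mon_ideal_sub => [|m /shiftP[h Hh ->]].
    have [H0 HD HM] := mon_ideal_is_ideal K upH.
    split; first by exists 0; rewrite ?mulr0.
      by move=> _ _ [f fH <-] [g gH <-]; exists (f + g); rewrite ?mulrDr //; apply: HD.
    by move=> a _ [f fH <-]; exists (a * f); rewrite 1?mulrCA //; apply: HM.
  by exists 'X_[h]; [apply/mon_idealX | rewrite mpolyXD].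
case/msuppM_le/allpairsP=> [[m1 m2] /= [+ /fH Hm2 ->]].
by rewrite msuppX mem_seq1 => /eqP ->; apply/shiftP; exists m2.
Qed.

(* [X] is the set of variables on which [H] depends, and [eps] the least number of
   associated primes covering [X]. *)
Variables (mu : mon) (H : set mon) (X : {set 'I_n}) (eps : nat).
Hypothesis upH : upset H.
Hypothesis freeH : forall m k, k \notin X -> H (m + U_(k))%MM -> H m.
Hypothesis exH : exists m, H m.
Local Notation G := (shift mu H).
(** The variables dividing [x^mu] but not occurring in [H]; each forms an associated prime on its
    own. *)
Let T := [set k | (mu k != 0%N) && (k \notin X)]%SET.

Lemma upset_shift : upset G.
Proof.
move=> m m' [le Hm] le'; split; first exact: lepm_trans le'.
apply: upH Hm _; apply/mnm_lepP => i; rewrite !mnmBE.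
by have /mnm_lepP/(_ i) := le'; lia.
Qed.

Lemma assoc_shift Y : Y \in assoc_primes H -> Y \in assoc_primes G.
Proof.
move=> /assoc_primesP[w [wY wN]]; apply/assoc_primesP; exists (mu + w)%MM.
split=> [k kY|m wm]; rewrite -addmA; first by apply/shiftD/wY.
by move/shiftD; apply: wN.
Qed.

(** The witness is [x^mu / x_y] times an element of [H] free of [y]: multiples by other variables
    never recover the missing [x_y]. *)
Lemma assoc_shift_single y : y \in T -> [set y]%SET \in assoc_primes G.
Proof.
rewrite inE => /andP[my yX]; have [h Hh hy] : exists2 h, H h & h y = 0%N.
  have [m Hm] := exH; move: {2}(m y) (erefl (m y)) Hm => k.
  elim: k m => [|k IHk] m mk Hm; first by exists m.
  apply: (IHk (m - U_(y))%MM); first by rewrite mnmBE mnm1E eqxx mk subn1.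
  by apply: freeH yX _; rewrite submK // lep1mP mk.
apply/assoc_primesP; exists (mu - U_(y) + h)%MM; split=> [k|m].
  rewrite inE => /eqP ->; rewrite -addmA (addmC h) addmA submK ?lep1mP //.
  exact/shiftD.
rewrite /var_weight big_set1 => m0 [/mnm_lepP/(_ y)].
by rewrite !mnmDE mnmBE mnm1E eqxx hy m0; lia.
Qed.

Lemma assoc_shift_sub Y : Y \in assoc_primes G -> Y \subset T :|: X.
Proof.
move=> /assoc_primesP[w [wY wN]]; apply/fintype.subsetP => k kY.
rewrite !inE; apply: contrapT => /negP; rewrite negb_or negb_and !negbK.
case/andP=> /orP[/eqP muk|->] // kX; apply: (wN 0%MM).
  by rewrite /var_weight big1 // => i _; rewrite mnm0E.
rewrite addm0; have [le Hw] := wY k kY.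
have le' : (mu <= w)%MM.
  apply/mnm_lepP => i; have /mnm_lepP/(_ i) := le; rewrite mnmDE mnm1E.
  by case: (eqVneq k i) => [<-|]; rewrite ?muk ?addn0.
split=> //; apply: freeH kX _; rewrite (_ : (_ + _)%MM = (w + U_(k) - mu)%MM) //.
by apply/mnmP => i; have /mnm_lepP/(_ i) := le'; rewrite !(mnmDE, mnmBE); lia.
Qed.

(** The witness [w] falls short of [mu] at [y], a defect that multiplication by another variable
    cannot repair. *)
Lemma assoc_shift_meet Y y : Y \in assoc_primes G -> y \in T -> y \in Y ->
  Y = [set y]%SET.
Proof.
move=> /assoc_primesP[w [wY wN]]; rewrite inE => /andP[my yX] yY.
have ltw : (w y < mu y)%N.
  rewrite ltnNge; apply/negP => le_mu; have [le Hw] := wY y yY.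
  have le' : (mu <= w)%MM.
    apply/mnm_lepP => i; have /mnm_lepP/(_ i) := le; rewrite mnmDE mnm1E.
    by case: (eqVneq y i) => [<-|]; rewrite ?addn0.
  apply: (wN 0%MM); first by rewrite /var_weight big1 // => i _; rewrite mnm0E.
  rewrite addm0; split=> //; apply: freeH yX _.
  rewrite (_ : (_ + _)%MM = (w + U_(y) - mu)%MM) //.
  by apply/mnmP => i; have /mnm_lepP/(_ i) := le'; rewrite !(mnmDE, mnmBE); lia.
apply/finset.setP => k; rewrite inE; apply/idP/eqP => [kY|-> //].
have [/mnm_lepP/(_ y) le _] := wY k kY; apply/eqP; apply: contraTT ltw => ky.
by move: le; rewrite mnmDE mnm1E (negPf ky) addn0 -leqNgt.
Qed.

(** A primary component that misses [x^t] but contains [x_p x^t] must have [x_p] in its radical. *)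
Lemma ex_assoc_prime t p N :
    (forall m, G m -> exists g : mon, [/\ G g, (g <= m)%MM & forall i, (g i <= N)%N]) ->
    ~ G t -> G (t + U_(p))%MM ->
  exists2 Y, Y \in assoc_primes G & p \in Y.
Proof.
move=> boundG Gt Gtp.
have [r [Q decQ]] := ex_irredundant_primary_dec K upset_shift boundG.
have [Gs [Xs [QE GX]]] := dec_exps decQ.
have [i nGi] : exists i, ~ Gs i t.
  by apply: contrapT => /forallNP ni; apply: Gt; apply/(dec_mem decQ QE) => i; apply: contrapT (ni i).
exists (Xs i); first exact: (dec_vars_assoc decQ QE GX).
apply: contrapT => /negP pX; have [_ _ freei _] := GX i; apply: nGi; apply: freei pX _.
by have /(dec_mem decQ QE) := Gtp; apply.
Qed.

Hypothesis coverX : exists F, [/\ F \subset assoc_primes G, X \subset finset.cover F &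
  (#|F| <= eps)%N].
Hypothesis cover_min : forall F, F \subset assoc_primes G -> X \subset finset.cover F ->
  (eps <= #|F|)%N.
Hypothesis eps_pos : (0 < #|~: X| + eps)%N.

(** A covering family contains all singletons of [T], and its other members cover [X]. Hence the
    minimum is [#|T| + eps], the height is [#|T| + #|X|], and the contribution of [T] cancels. *)
Lemma size_shift s : has_size (mon_ideal G : set S) s -> s.+1 = (#|~: X| + eps)%N.
Proof.
move=> /(has_sizeP upset_shift)[a [-> [F [sF cF] <-] minF]].
pose F1 := [set [set y]%SET | y in T]%SET.
have cardF1 : #|F1| = #|T| by rewrite card_imset //; apply: set1_inj.
have sF1 : F1 \subset assoc_primes G.
  by apply/fintype.subsetP => _ /imsetP[y yT ->]; apply: assoc_shift_single.
have dTX : T :&: X = finset.set0.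
  by apply/finset.setP => k; rewrite !inE -andbA andNb andbF.
have [FX [sFX cFX cardFX]] := coverX.
have coverG : finset.cover (assoc_primes G) = T :|: X.
  apply/eqP; rewrite finset.eqEsubset; apply/andP; split.
    by apply/finset.bigcupsP => Y; apply: assoc_shift_sub.
  apply/fintype.subsetP => k; rewrite finset.in_setU => /orP[kT|kX].
    by apply/finset.bigcupP; exists [set k]%SET; [exact: assoc_shift_single | rewrite inE].
  have /finset.bigcupP[Y YF kY] := fintype.subsetP cFX k kX.
  by apply/finset.bigcupP; exists Y => //; apply: (fintype.subsetP sFX).
have cardG : #|finset.cover (assoc_primes G)| = (#|T| + #|X|)%N.
  by rewrite coverG cardsU dTX cards0 subn0.
have le1 : (#|F| <= #|T| + eps)%N.
  apply: leq_trans (minF (F1 :|: FX) _) _.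
    split; first by rewrite finset.subUset sF1.
    apply/eqP; rewrite finset.eqEsubset; apply/andP; split.
      apply/finset.bigcupsP => Y YF; apply: (finset.bigcup_sup Y) => //.
      by apply: fintype.subsetP YF; rewrite finset.subUset sF1.
    rewrite coverG; apply/fintype.subsetP => k; rewrite finset.in_setU => /orP[kT|kX].
      apply/finset.bigcupP; exists [set k]%SET; rewrite ?inE //.
      by apply/orP; left; apply: imset_f.
    have /finset.bigcupP[Y YF kY] := fintype.subsetP cFX k kX.
    by apply/finset.bigcupP; exists Y => //; rewrite inE YF orbT.
  by rewrite (leq_trans (leq_card_setU _ _)) // cardF1 leq_add2l.
have F1F : F1 \subset F.
  apply/fintype.subsetP => _ /imsetP[y yT ->].
  have /finset.bigcupP[Y YF yY] : y \in finset.cover F by rewrite cF coverG inE yT.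
  by rewrite -(assoc_shift_meet (fintype.subsetP sF _ YF) yT yY).
have le2 : (#|T| + eps <= #|F|)%N.
  rewrite -(cardsID F1 F) (finset.setIidPr F1F) cardF1 leq_add2l.
  apply: cover_min; first exact: fintype.subset_trans (finset.subsetDl _ _) sF.
  apply/fintype.subsetP => k kX.
  have /finset.bigcupP[Y YF kY] : k \in finset.cover F by rewrite cF coverG inE kX orbT.
  apply/finset.bigcupP; exists Y => //; rewrite inE YF andbT.
  apply/imsetP => -[y yT e]; move: kY; rewrite e inE => /eqP ky.
  by move: yT; rewrite inE -ky kX andbF.
have le3 : (#|T| + #|X| <= n)%N.
  by rewrite -cardG -[X in (_ <= X)%N]card_ord max_card.
(* [eps_pos] keeps the subtraction of 1 in the size from being truncated. *)
have := cardsC X; rewrite card_ord cardG; move: eps_pos; lia.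
Qed.

(** The factor [x^mu] does not change regular sequences. The variables outside [X] followed by [es]
    are regular, the pairwise condition being immediate when the first variable is outside [X]. *)
Lemma depth_shift (es : seq 'I_n) :
    size es = eps -> uniq es -> {subset es <= X} ->
    pairwise (fun y z => `[< forall t, H (t + U_(y))%MM -> H (t + U_(z))%MM -> H t >]) es ->
    (forall fs, [set` fs] `<=` @max_ideal K n ->
      regular_seq (mon_ideal H : set (S^o)) fs -> (size fs <= #|~: X| + eps)%N) ->
  depth_ideal (mon_ideal G : set S) (#|~: X| + eps)%N.
Proof.
move=> size_es uniq_es esX pw_es ub.
have idH := mon_ideal_is_ideal K upH.
have reg : GRing.lreg ('X_[mu] : S).
  by apply/lregP; rewrite -msupp_eq0 msuppX.
rewrite /depth_ideal mon_ideal_shift //; split; last first.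
  by move=> fs fsm /(regular_seq_mul _ reg idH); apply: ub.
exists [seq 'X_z | z <- enum (~: X) ++ es]; split.
- by rewrite size_map size_cat -cardE size_es.
- move=> _ /mapP[z _ ->] I [_ sI]; apply: sI; exact: imageP.
apply/(regular_seq_mul _ reg idH); apply: regular_vars => //.
  rewrite cat_uniq enum_uniq uniq_es andbT /=.
  by apply/hasPn => z /esX zX; rewrite mem_enum inE negbK.
have R y z : y \notin X ->
    `[< forall t, H (t + U_(y))%MM -> H (t + U_(z))%MM -> H t >].
  by move=> yX; apply/asboolP => t /freeH -/(_ yX).
rewrite pairwise_cat pw_es andbT; apply/andP; split.
  by apply/allrelP => y z; rewrite mem_enum inE => yX _; apply: R.
have : {subset enum (~: X) <= ~: X} by move=> z; rewrite mem_enum.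
elim: (enum _) => //= z s IHs sub; rewrite IHs ?andbT => [|y ys]; last first.
  by apply: sub; rewrite inE ys orbT.
apply/allP => y _; apply: R; have := sub z (mem_head _ _).
by rewrite inE.
Qed.

End ShiftedMonomialIdeals.

(** * Criteria for minimal depth with zero, one or two covering primes *)

Section MinimalDepthCriteria.
Variables (K : fieldType) (n : nat).
Local Notation S := {mpoly K[n]}.
Local Notation mon := 'X_{1..n}.
Variables (mu : mon) (H : set mon) (X : {set 'I_n}) (N : nat).
Implicit Types (m w t : mon) (Y : {set 'I_n}) (F : {set {set 'I_n}}).
Hypothesis upH : upset H.
Hypothesis freeH : forall m k, k \notin X -> H (m + U_(k))%MM -> H m.
Hypothesis exH : exists m, H m.
Local Notation G := (shift mu H).
Hypothesis boundG : forall m, G m ->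
  exists g : mon, [/\ G g, (g <= m)%MM & forall i, (g i <= N)%N].
Hypothesis properG : ~ G 0%MM.

Lemma minimal_depth_shift :
  (forall s, has_size (mon_ideal G : set S) s -> depth_ideal (mon_ideal G : set S) s.+1) ->
  minimal_depth (mon_ideal G : set S).
Proof.
split=> //; apply: ex_has_size boundG _ _ => //; first exact: upset_shift.
by have [h Hh] := exH; exists (mu + h)%MM; apply/shiftD.
Qed.

Lemma minimal_depth_principal : (0 < n)%N -> X = finset.set0 -> (forall m, H m) ->
  minimal_depth (mon_ideal G : set S).
Proof.
move=> n_gt0 X0 allH; apply: minimal_depth_shift => s.
have cX : #|~: X| = n by rewrite X0 finset.setC0 cardsT card_ord.
have pos : (0 < #|~: X| + 0)%N by rewrite cX addn0.
have F0 : exists F, [/\ F \subset assoc_primes G, X \subset finset.cover F & (#|F| <= 0)%N].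
  by exists finset.set0; rewrite finset.sub0set X0 finset.sub0set cards0.
move/(size_shift upH freeH exH F0 (fun _ _ _ => leq0n _) pos) => ->.
apply: (@depth_shift _ _ mu H X 0 upH freeH exH [::]) => // fs fsm.
have -> : mon_ideal H = [set: S] by apply/seteqP; split=> // f _ m _.
by rewrite cX addn0; apply: regular_seq_unit_le.
Qed.

Lemma assoc_primes_pair p q Y :
  (forall t, H (t + U_(p))%MM -> H (t + U_(q))%MM -> H t) -> p != q ->
  Y \in assoc_primes G -> p \in Y -> q \in Y -> False.
Proof.
move=> Hpq pq /assoc_primesP[w [wY wN]] pY qY.
have [[/mnm_lepP lep Hp] [/mnm_lepP leq Hq]] := (wY p pY, wY q qY).
have le' : (mu <= w)%MM.
  apply/mnm_lepP => i; have := lep i; have := leq i; rewrite !mnmDE !mnm1E.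
  by case: (eqVneq q i) => [<-|_]; rewrite ?(negPf pq) addn0.
apply: (wN 0%MM); first by rewrite /var_weight big1 // => i _; rewrite mnm0E.
rewrite addm0; split=> //; apply: Hpq.
  rewrite (_ : (_ + _)%MM = (w + U_(p) - mu)%MM) //.
  by apply/mnmP => i; have /mnm_lepP/(_ i) := le'; rewrite !(mnmDE, mnmBE); lia.
rewrite (_ : (_ + _)%MM = (w + U_(q) - mu)%MM) //.
by apply/mnmP => i; have /mnm_lepP/(_ i) := le'; rewrite !(mnmDE, mnmBE); lia.
Qed.

(** Here [eps = 1]: [w] makes [X] itself an associated prime, and the Koszul bound is used with [E]
    empty. *)
Lemma minimal_depth_socle p w : p \in X ->
  var_weight (~: X) w = 0%N -> ~ H w -> (forall i, i \in X -> H (w + U_(i))%MM) ->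
  minimal_depth (mon_ideal G : set S).
Proof.
move=> pX wX nHw wH; apply: minimal_depth_shift => s.
have pos : (0 < #|~: X| + 1)%N by rewrite addn1.
have F1 : exists F, [/\ F \subset assoc_primes G, X \subset finset.cover F & (#|F| <= 1)%N].
  exists [set X]%SET; rewrite cards1; split=> //.
    rewrite finset.sub1set; apply: assoc_shift; apply/assoc_primesP; exists w; split=> //.
    by move=> m wm /(free_exps freeH wm).
  by apply/fintype.subsetP => i iX; apply/finset.bigcupP; exists X; rewrite ?inE.
have minF F : F \subset assoc_primes G -> X \subset finset.cover F -> (1 <= #|F|)%N.
  move=> _ /fintype.subsetP/(_ p pX)/finset.bigcupP[Y YF _].
  by rewrite card_gt0; apply/finset.set0Pn; exists Y.
move/(size_shift upH freeH exH F1 minF pos) => ->.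
apply: (@depth_shift _ _ mu H X 1 upH freeH exH [:: p]) => //.
  by move=> i; rewrite inE => /eqP ->.
move=> fs fsm reg; have := @regular_seq_socle_le _ _ H X finset.set0 p w fs upH.
rewrite cards0 addn0 addn1; apply=> //.
- exact: finset.sub0set.
- by rewrite finset.setD0.
- by rewrite finset.setD0.
- by move=> e t; rewrite inE.
Qed.

(** Here [eps = 2]: [w] gives the prime of [X :\ p], [t] gives one containing [p], and no prime
    contains both [p] and [q]. The Koszul bound is used with [E] reduced to [p]. *)
Lemma minimal_depth_pair p q w t : p \in X -> q \in X -> p != q ->
  (forall m, H (m + U_(p))%MM -> H (m + U_(q))%MM -> H m) ->
  ~ H t -> H (t + U_(p))%MM ->
  var_weight (~: X) w = 0%N -> (forall k, ~ H (w + U_(p) *+ k)%MM) ->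
  (forall i, i \in X :\ p -> H (w + U_(i))%MM) ->
  (forall m, w = (m + U_(p))%MM -> ~ H (m + U_(q))%MM) ->
  minimal_depth (mon_ideal G : set S).
Proof.
move=> pX qX pq Hpq nHt Htp wX nHw wH wpq; apply: minimal_depth_shift => s.
have pos : (0 < #|~: X| + 2)%N by rewrite addn2.
have Xp : (X :\ p)%SET \in assoc_primes G.
  apply: assoc_shift; apply/assoc_primesP; exists w; split=> // m m0 Hwm.
  (* Apart from its power of [x_p], [m] only involves variables outside [X], which are removed by
     freeness. *)
  apply: (nHw (m p)); have em : m = (U_(p) *+ m p + (m - U_(p) *+ m p))%MM.
    apply/mnmP => i; rewrite mnmDE mnmBE mulmnE mnm1E.
    by case: (eqVneq p i) => [->|_]; lia.
  move: Hwm; rewrite {1}em addmA; apply: free_exps freeH _.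
  apply/eqP; rewrite /var_weight sum_nat_eq0; apply/forall_inP => i iX.
  rewrite mnmBE mulmnE mnm1E; have [->|pi] := eqVneq p i; first by rewrite mul1n subnn.
  move/eqP: m0; rewrite /var_weight sum_nat_eq0 => /forall_inP/(_ i).
  by rewrite !inE iX eq_sym pi => /(_ isT)/eqP ->.
have F2 : exists F, [/\ F \subset assoc_primes G, X \subset finset.cover F & (#|F| <= 2)%N].
  have [||Y YG pY] := @ex_assoc_prime K n mu H upH (mu + t)%MM p N boundG.
  - by move/shiftD.
  - by rewrite -addmA; apply/shiftD.
  exists [set (X :\ p)%SET; Y]%SET; split.
  - by apply/fintype.subsetP => Z; rewrite in_set2 => /orP[/eqP ->|/eqP ->].
  - apply/fintype.subsetP => i iX; apply/finset.bigcupP.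
    have [->|ip] := eqVneq i p; first by exists Y; rewrite // !inE eqxx orbT.
    by exists (X :\ p)%SET; rewrite !inE ?eqxx // ip.
  - by rewrite cards2; case: (_ != _).
have minF F : F \subset assoc_primes G -> X \subset finset.cover F -> (2 <= #|F|)%N.
  move=> sF /fintype.subsetP sX; rewrite ltnNge; apply/negP => F1.
  have /finset.bigcupP[Y YF pY] := sX p pX; have /finset.bigcupP[Z ZF qZ] := sX q qX.
  have YZ : Y = Z by apply: (card_le1_eqP F1).
  have YG := fintype.subsetP sF Y YF.
  by apply: (assoc_primes_pair Hpq pq YG pY); rewrite YZ.
move/(size_shift upH freeH exH F2 minF pos) => ->.
apply: (@depth_shift _ _ mu H X 2 upH freeH exH [:: p; q]) => //.
- by rewrite /= inE pq.
- by move=> i; rewrite !inE => /orP[/eqP ->|/eqP ->].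
- by rewrite /= !andbT; apply/asboolP.
move=> fs fsm reg; have := @regular_seq_socle_le _ _ H X [set p]%SET q w fs upH.
rewrite cards1 addn1 addn2; apply=> //.
- by rewrite finset.sub1set.
- by rewrite !inE eq_sym pq.
- by move=> Hw; apply: (nHw 0%N); rewrite mulm0n addm0.
- by move=> e m; rewrite inE => /eqP ->; apply: wpq.
Qed.

End MinimalDepthCriteria.

(** * Lexsegments *)

Section LexSegments.
Variable n : nat.
Local Notation mon := 'X_{1..n}.
Implicit Types (m w t a b g : mon) (i j p r z : 'I_n).

(** In equal degrees the canonical order, which compares degrees first, reduces to the pure
    lexicographic one. *)
Lemma lex_geE a b : mdeg a = mdeg b -> lex_ge a b = (b <= a)%O.
Proof. by move=> e; rewrite leEmnm e lexi_cons lexx. Qed.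

Lemma lex_lt_at i a b : mdeg a = mdeg b -> (forall j, (j < i)%N -> a j = b j) ->
  (a i < b i)%N -> (a < b)%O.
Proof. by move=> e eq_lt lt; apply/(ltmcP e); exists i. Qed.

Lemma lex_monU i j : (i <= j)%N -> (U_(j)%MM <= U_(i)%MM)%O.
Proof.
rewrite leq_eqVlt => /orP[/eqP/val_inj -> //|ij]; apply: ltW.
apply: (@lex_lt_at i); first by rewrite !mdeg1.
  move=> k ki; by rewrite !mnm1E -!val_eqE !gtn_eqF // (ltn_trans ki).
by rewrite !mnm1E eqxx -val_eqE gtn_eqF.
Qed.

Lemma mon_subU a i : a i != 0%N -> a = (a - U_(i) + U_(i))%MM.
Proof. by move=> ai; rewrite submK // lep1mP. Qed.

Lemma mon_ex_var a : mdeg a != 0%N -> exists i, a i != 0%N.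
Proof. by rewrite mdegE sum_nat_eq0 => /forall_inPn[i _ ai]; exists i. Qed.

Lemma lex_le_pow r a : (forall i, (i < r)%N -> a i = 0%N) ->
  (a <= (U_(r) *+ mdeg a)%MM)%O.
Proof.
move: {2}(mdeg a) (erefl (mdeg a)) => d; elim: d a => [|d IHd] a da az.
  by move/eqP: da; rewrite mdeg_eq0 => /eqP ->; rewrite le0m.
have [i ai] : exists i, a i != 0%N by apply: mon_ex_var; rewrite da.
have ea := mon_subU ai; have da' : mdeg (a - U_(i))%MM = d.
  by move: da; rewrite {1}ea mdegD mdeg1 addn1 => -[].
rewrite da mulmSr {1}ea; apply: lem_add.
  by rewrite -da'; apply: IHd => // j jr; rewrite mnmBE az.
by apply: lex_monU; rewrite leqNgt; apply: contra ai => ir; rewrite az.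
Qed.

Lemma lex_ge_pow z a : (forall i, (i <= z)%N) -> ((U_(z) *+ mdeg a)%MM <= a)%O.
Proof.
move=> zmax; move: {2}(mdeg a) (erefl (mdeg a)) => d; elim: d a => [|d IHd] a da.
  by rewrite da mulm0n le0m.
have [i ai] : exists i, a i != 0%N by apply: mon_ex_var; rewrite da.
have ea := mon_subU ai; have da' : mdeg (a - U_(i))%MM = d.
  by move: da; rewrite {1}ea mdegD mdeg1 addn1 => -[].
rewrite da mulmSr {1}ea; apply: lem_add; last exact: lex_monU.
by rewrite -da'; apply: IHd.
Qed.

Lemma mon_two_vars p r a : p != r -> (forall i, i != p -> i != r -> a i = 0%N) ->
  a = (U_(p) *+ a p + U_(r) *+ a r)%MM.
Proof.
move=> pr az; apply/mnmP => i; rewrite mnmDE !mulmnE !mnm1E.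
have [<-|pi] := eqVneq p i; first by rewrite eq_sym (negPf pr) mul1n mul0n addn0.
have [<-|ri] := eqVneq r i; first by rewrite mul1n mul0n.
by rewrite az 1?eq_sym // !mul0n.
Qed.

Lemma lepm_mdeg a b : (a <= b)%MM -> (mdeg a <= mdeg b)%N.
Proof. by move=> /submK <-; rewrite mdegD leq_addl. Qed.

Lemma lepm_mdeg_eq a b : (a <= b)%MM -> mdeg a = mdeg b -> a = b.
Proof.
move=> /submK e d; rewrite -e; suff -> : (b - a)%MM = 0%MM by rewrite add0m.
by apply/eqP; rewrite -mdeg_eq0; have := congr1 mdeg e; rewrite mdegD; lia.
Qed.

(** * Lexsegments with first monomial divisible by x_p and last one not *)

Section ReducedSegment.
Variables (d : nat) (u v : mon) (p : 'I_n).
Hypothesis du : mdeg u = d.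
Hypothesis dv : mdeg v = d.
Hypothesis d_gt0 : (0 < d)%N.
Hypothesis up : (0 < u p)%N.
Hypothesis vp : v p = 0%N.
Hypothesis uz : forall j, (j < p)%N -> u j = 0%N.
Hypothesis vz : forall j, (j < p)%N -> v j = 0%N.

Definition segment : set mon := [set m | [/\ mdeg m = d, (v <= m)%O & (m <= u)%O]].
Local Notation L := segment.
Local Notation H := (up_closure L).

Definition segment_vars : {set 'I_n} := [set i | `[< exists2 g, L g & g i != 0%N >]].
Local Notation X := segment_vars.

Lemma segment_varsP i : reflect (exists2 g, L g & g i != 0%N) (i \in X).
Proof. by rewrite inE; apply: asboolP. Qed.

Lemma segment_varsPn i g : i \notin X -> L g -> g i = 0%N.
Proof. by move=> iX Lg; apply/eqP; apply: contraNT iX => gi; apply/segment_varsP; exists g. Qed.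

Lemma segment_free m k : k \notin X -> H (m + U_(k))%MM -> H m.
Proof.
move=> kX [g Lg le]; exists g => //; apply/mnm_lepP => i.
move/mnm_lepP/(_ i): le; rewrite mnmDE mnm1E.
by case: (eqVneq k i) => [<-|_]; rewrite ?addn0 // (segment_varsPn kX).
Qed.

Lemma segment_low g j : L g -> (j < p)%N -> g j = 0%N.
Proof.
move=> [dg _ gu] jp; move: gu; rewrite le_eqVlt => /orP[/eqP ->|]; first exact: uz.
case/(ltmcP (etrans dg (esym du))) => i ei gi.
have ip : (p <= i)%N by rewrite leqNgt; apply/negP => ip; rewrite uz in gi.
by rewrite ei ?uz // (leq_trans jp).
Qed.

Lemma segment_vars_ge i : i \in X -> (p <= i)%N.
Proof.
case/segment_varsP => g Lg gi; rewrite leqNgt; apply/negP => ip.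
by rewrite (segment_low Lg ip) in gi.
Qed.

Lemma segment_of_gt m : mdeg m = d -> (forall j, (j < p)%N -> m j = 0%N) ->
  (0 < m p)%N -> (m <= u)%O -> L m.
Proof.
move=> dm mz mp mu; split=> //; apply: ltW; apply: (@lex_lt_at p); rewrite ?dm ?vp //.
by move=> j jp; rewrite vz ?mz.
Qed.

Lemma segment_of_eq0 m : mdeg m = d -> (forall j, (j <= p)%N -> m j = 0%N) ->
  (v <= m)%O -> L m.
Proof.
move=> dm mz vm; split=> //; apply: ltW; apply: (@lex_lt_at p); rewrite ?dm ?mz //.
by move=> j jp; rewrite uz ?mz // ltnW.
Qed.

Lemma segment_u : L u.
Proof. by apply: segment_of_gt. Qed.

Lemma segment_v : L v.
Proof.
by apply: segment_of_eq0 => // j; rewrite leq_eqVlt => /orP[/eqP/val_inj -> //|/vz].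
Qed.

Lemma segment_mdeg m : H m -> (d <= mdeg m)%N.
Proof. by case=> g [<- _ _] /lepm_mdeg. Qed.

Lemma segment_pX : p \in X.
Proof. by apply/segment_varsP; exists u; [apply: segment_u | rewrite -lt0n]. Qed.

Lemma segment_weight m : (forall i, i \notin X -> m i = 0%N) -> var_weight (~: X) m = 0%N.
Proof. by move=> mX; rewrite /var_weight big1 // => i; rewrite inE => /mX. Qed.

Local Notation u' := (u - U_(p))%MM.

Lemma segment_uE : u = (u' + U_(p))%MM.
Proof. by apply: mon_subU; rewrite -lt0n. Qed.

Lemma segment_du' : mdeg u' = d.-1.
Proof. by have := du; rewrite {1}segment_uE mdegD mdeg1; lia. Qed.

Variable z : 'I_n.
Hypothesis zmax : forall i : 'I_n, (i <= z)%N.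

(** [u'] has degree below [d], and for [i] in [X] the product [u' x_i] lies between [u' x_z] and
    [u' x_p = u]. In degree 1 the generators are the variables of [X]. *)
Lemma segment_socle : d = 1%N \/ (v <= (u' + U_(z))%MM)%O ->
  [/\ var_weight (~: X) u' = 0%N, ~ H u' & forall i, i \in X -> H (u' + U_(i))%MM].
Proof.
move=> hyp; split.
- by apply: segment_weight => i iX; rewrite mnmBE (segment_varsPn iX segment_u).
- by move/segment_mdeg; rewrite segment_du'; lia.
- move=> i iX; case: hyp => [d1|vz']; last first.
    exists (u' + U_(i))%MM; last exact: lepm_refl.
    split.
    + by rewrite mdegD mdeg1 segment_du'; lia.
    + by apply: le_trans vz' _; rewrite lemc_add2r lex_monU.
    + by rewrite [X in (_ <= X)%O]segment_uE lemc_add2r lex_monU // segment_vars_ge.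
  case/segment_varsP: iX => g Lg gi; exists g => //.
  suff -> : g = U_(i)%MM by apply: lem_addl.
  have [dg _ _] := Lg; apply/esym/lepm_mdeg_eq; first by rewrite lep1mP.
  by rewrite mdeg1 dg.
Qed.

Hypothesis d_gt1 : (1 < d)%N.
Hypothesis vbig : ((u' + U_(z))%MM < v)%O.

Lemma segment_p_lt_z : (p < z)%N.
Proof.
rewrite ltnNge; apply/negP => zp; have := congr1 S dv; rewrite mdegE.
rewrite big1 ?(ltn_eqF d_gt0) => [/eqP|i _]; first by case: d d_gt0.
have := leq_trans (zmax i) zp; rewrite leq_eqVlt => /orP[/eqP/val_inj -> //|/vz //].
Qed.

Let pz : (p == z) = false.
Proof. by rewrite -val_eqE ltn_eqF // segment_p_lt_z. Qed.

(** Otherwise [u'] would still be divisible by [x_p], making [u' x_z] larger than [v]. *)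
Lemma segment_up1 : u p = 1%N.
Proof.
apply/eqP; rewrite eqn_leq up andbT leqNgt; apply/negP => up2.
suff : (v < (u' + U_(z))%MM)%O by rewrite ltNge (ltW vbig).
apply: (@lex_lt_at p).
- by rewrite mdegD mdeg1 segment_du' dv; lia.
- move=> j jp; rewrite mnmDE mnmBE uz // vz // sub0n add0n mnm1E -val_eqE.
  by rewrite gtn_eqF // (ltn_trans jp segment_p_lt_z).
- by rewrite mnmDE mnmBE !mnm1E eqxx vp; lia.
Qed.

Lemma segment_p_le1 g : L g -> (g p <= 1)%N.
Proof.
move=> Lg; have [dg _ gu] := Lg; rewrite -segment_up1 leqNgt; apply/negP => ltp.
suff : (u < g)%O by rewrite ltNge gu.
apply: (@lex_lt_at p); rewrite ?dg // => j jp.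
by rewrite uz // (segment_low Lg).
Qed.

Lemma segment_u'_low j : (j <= p)%N -> u' j = 0%N.
Proof.
rewrite leq_eqVlt mnmBE => /orP[/eqP/val_inj ->|/uz ->//].
by rewrite segment_up1 mnm1E eqxx.
Qed.

Lemma segment_sub_p g : L g -> g p = 1%N ->
  [/\ g = (g - U_(p) + U_(p))%MM, mdeg (g - U_(p))%MM = d.-1, ((g - U_(p))%MM <= u')%O &
      forall j, (j <= p)%N -> (g - U_(p))%MM j = 0%N].
Proof.
move=> Lg gp; have [dg _ gu] := Lg.
have eg : g = (g - U_(p) + U_(p))%MM by apply: mon_subU; rewrite gp.
split=> //.
- by move: dg; rewrite {1}eg mdegD mdeg1; lia.
- by move: gu; rewrite {1}eg {1}segment_uE lemc_add2l.
- move=> j; rewrite leq_eqVlt mnmBE => /orP[/eqP/val_inj ->|jp].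
    by rewrite gp mnm1E eqxx.
  by rewrite (segment_low Lg).
Qed.

Lemma segment_pU a : mdeg a = d.-1 -> (forall j, (j <= p)%N -> a j = 0%N) ->
  (a <= u')%O -> L (a + U_(p))%MM.
Proof.
move=> da az au; apply: segment_of_gt.
- by rewrite mdegD mdeg1 da; lia.
- by move=> j jp; rewrite mnmDE az ?(ltnW jp) // mnm1E -val_eqE gtn_eqF.
- by rewrite mnmDE mnm1E eqxx addn1.
- by rewrite segment_uE lemc_add2l.
Qed.

Lemma segment_zX : z \in X.
Proof.
apply/segment_varsP; exists (U_(z) *+ d.-1 + U_(p))%MM.
  apply: segment_pU; last by rewrite -segment_du'; apply: lex_ge_pow.
    by rewrite mdegMn mdeg1 mul1n.
  move=> j jp; rewrite mulmnE mnm1E -val_eqE gtn_eqF //.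
  exact: leq_ltn_trans jp segment_p_lt_z.
by rewrite mnmDE mulmnE mnm1E eqxx; lia.
Qed.

(* No associated prime contains both x_p and x_z. *)
Lemma segment_pz_colon t : H (t + U_(p))%MM -> H (t + U_(z))%MM -> H t.
Proof.
move=> [g1 Lg1 /mnm_lepP le1] [g2 Lg2 /mnm_lepP le2]; apply: contrapT => nHt.
have nle g : L g -> ~ (forall i, (g i <= t i)%N).
  by move=> Lg le; apply: nHt; exists g => //; apply/mnm_lepP.
(* Neither generator divides [x^t], so each must exceed it in the one variable that was added. *)
have g1p : g1 p = (t p).+1.
  apply/eqP; rewrite eqn_leq; have := le1 p; rewrite mnmDE mnm1E eqxx addn1 => -> /=.
  rewrite ltnNge; apply/negP => gp; apply: (nle g1 Lg1) => i.
  by have := le1 i; rewrite mnmDE mnm1E; case: (eqVneq p i) => [<-|_]; rewrite ?addn0.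
have g2z : g2 z = (t z).+1.
  apply/eqP; rewrite eqn_leq; have := le2 z; rewrite mnmDE mnm1E eqxx addn1 => -> /=.
  rewrite ltnNge; apply/negP => gp; apply: (nle g2 Lg2) => i.
  by have := le2 i; rewrite mnmDE mnm1E; case: (eqVneq z i) => [<-|_]; rewrite ?addn0.
have tp : t p = 0%N by have := segment_p_le1 Lg1; rewrite g1p; lia.
have [e1 da au az] := segment_sub_p Lg1 (etrans g1p (congr1 S tp)).
set a := (g1 - U_(p))%MM in da au az; set b := (g2 - U_(z))%MM.
have e2 : g2 = (b + U_(z))%MM by apply: mon_subU; rewrite g2z.
have [dg2 vg2 _] := Lg2.
have db : mdeg b = d.-1 by move: dg2; rewrite {1}e2 mdegD mdeg1; lia.
have b_t i : (b i <= t i)%N.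
  by have := le2 i; rewrite {1}e2 !mnmDE leq_add2r.
have a_t i : (a i <= t i)%N.
  by have := le1 i; rewrite {1}e1 !mnmDE leq_add2r.
have bz j : (j <= p)%N -> b j = 0%N.
  rewrite leq_eqVlt => /orP[/eqP/val_inj ->|jp]; first by have := b_t p; rewrite tp; lia.
  by rewrite mnmBE (segment_low Lg2).
(* If [x^t] leaves room for some [x_k] after [x_p], then [b x_k] divides it and is a generator,
   being at least [b x_z = g2]. *)
have [/existsP[k /andP[pk bk]]|noex] := boolP [exists k : 'I_n, (p < k)%N && (b k < t k)%N].
  apply: (nle (b + U_(k))%MM).
    apply: segment_of_eq0.
    - by rewrite mdegD mdeg1 db; lia.
    - move=> j jp; rewrite mnmDE bz // mnm1E -val_eqE gtn_eqF //.
      exact: leq_ltn_trans jp pk.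
    - by apply: le_trans vg2 _; rewrite e2 lemc_add2r lex_monU.
  by move=> i; rewrite mnmDE mnm1E; case: (eqVneq k i) => [<-|_]; rewrite ?addn1 ?addn0.
(* Otherwise [b] agrees with [t] after [p], so [a] divides [b], of the same degree; then
   [g2 = a x_z] is at most [u' x_z], below [v]. *)
have ab : a = b.
  apply: lepm_mdeg_eq; last by rewrite da db.
  apply/mnm_lepP => i; have [ip|pi] := leqP i p; first by rewrite az.
  apply: leq_trans (a_t i) _; rewrite leqNgt; apply: contra noex => bi.
  by apply/existsP; exists i; rewrite pi.
suff : (g2 < v)%O by rewrite ltNge vg2.
by apply: le_lt_trans vbig; rewrite e2 -ab lemc_add2l.
Qed.

Lemma segment_r_proof : (p.+1 < n)%N.
Proof. exact: leq_ltn_trans segment_p_lt_z (ltn_ord z). Qed.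

(** The variable following [x_p], the largest that may occur in a generator free of [x_p]. *)
Let r : 'I_n := Ordinal segment_r_proof.

Let pr : (p == r) = false. Proof. by rewrite -val_eqE ltn_eqF. Qed.

Let vars_r i : i \in X :\ p -> (r <= i)%N.
Proof.
rewrite in_setD1 => /andP[ip /segment_vars_ge]; rewrite leq_eqVlt.
by case/orP=> // /eqP/val_inj e; rewrite e eqxx in ip.
Qed.

Let zero_r i j : (r <= i)%N -> (j <= p)%N -> U_(i)%MM j = 0%N.
Proof. by move=> ri jp; rewrite mnm1E -val_eqE gtn_eqF // (leq_ltn_trans jp). Qed.

(* [x^w] shows that the variables of [X] other than x_p generate an associated
   prime; the last condition makes the resulting Koszul class nonzero. *)
Definition pair_witness w := [/\ var_weight (~: X) w = 0%N,
  forall k, ~ H (w + U_(p) *+ k)%MM,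
  forall i, i \in X :\ p -> H (w + U_(i))%MM &
  forall m, w = (m + U_(p))%MM -> ~ H (m + U_(z))%MM].

(** A generator dividing [x_r^(d-1) x_p^k] must be [x_p x_r^(d-1)]. Then [x_r^(d-1)] is at most
    [u'], and [x_r^(d-1) x_z] is at most [u' x_z], below [v]. *)
Lemma pair_witness_small : (v <= (U_(r) *+ d.-1 + U_(z))%MM)%O -> pair_witness (U_(r) *+ d.-1)%MM.
Proof.
move=> vle; have rz : (r <= z)%N by exact: segment_p_lt_z.
have Li i : (r <= i)%N -> L (U_(r) *+ d.-1 + U_(i))%MM.
  move=> ri; apply: segment_of_eq0.
  - by rewrite mdegD mdegMn !mdeg1; lia.
  - by move=> j jp; rewrite mnmDE mulmnE !zero_r.
  - by apply: le_trans vle _; rewrite lemc_add2r lex_monU.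
split.
- apply: segment_weight => i iX; rewrite mulmnE mnm1E.
  have [e|//] := eqVneq r i; move: (segment_varsPn iX (Li z rz)).
  by rewrite mnmDE mulmnE mnm1E e eqxx; lia.
- move=> k [g Lg /mnm_lepP le]; have [dg _ gu] := Lg.
  have eg : g = (U_(p) *+ g p + U_(r) *+ g r)%MM.
    apply: mon_two_vars => [|i ip ir]; first by rewrite pr.
    have := le i; rewrite mnmDE !mulmnE !mnm1E eq_sym (negPf ir).
    by rewrite eq_sym (negPf ip) /=; lia.
  have gr : (g r <= d.-1)%N.
    by have := le r; rewrite mnmDE !mulmnE !mnm1E eqxx pr /=; lia.
  have gp := segment_p_le1 Lg.
  have := dg; rewrite {1}eg mdegD !mdegMn !mdeg1 => dg'.
  have [gp1 gr1] : g p = 1%N /\ g r = d.-1 by split; lia.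
  have [_ _ gu' _] := segment_sub_p Lg gp1.
  move: gu'; rewrite {1}eg gp1 gr1 mulm1n addmC addmK => gu'.
  suff : (v < v)%O by rewrite ltxx.
  by apply: le_lt_trans vle _; apply: le_lt_trans vbig; rewrite lemc_add2l.
- by move=> i iX; exists (U_(r) *+ d.-1 + U_(i))%MM; [apply/Li/vars_r | apply: lepm_refl].
- move=> m /mnmP/(_ p); rewrite mulmnE mnmDE !mnm1E eqxx eq_sym pr /=; lia.
Qed.

Section LargeLast.
Hypothesis vlarge : ((U_(r) *+ d.-1 + U_(z))%MM < v)%O.

Lemma segment_rX : r \in X.
Proof.
apply/segment_varsP; exists v; first exact: segment_v.
apply/negP => /eqP vr.
suff : (v < (U_(r) *+ d.-1 + U_(z))%MM)%O by rewrite ltNge (ltW vlarge).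
apply: (@lex_lt_at r).
- by rewrite mdegD mdegMn !mdeg1 dv; lia.
- move=> j jp; rewrite mnmDE mulmnE !zero_r ?segment_p_lt_z //.
  move: jp; rewrite ltnS leq_eqVlt => /orP[/eqP/val_inj -> //|/vz //].
- by rewrite mnmDE mulmnE mnm1E eqxx vr; lia.
Qed.

(** Generators have exponent at most 1 in [x_p], so one dividing [(u' / x_r) x_p^k] would divide a
    monomial of degree [d.-1]. Replacing [x_r] in [u'] by a later variable does not raise it, which
    gives the products with [x_i]. *)
Lemma pair_witness_mid : (0 < u' r)%N -> pair_witness (u' - U_(r) + U_(p))%MM.
Proof.
move=> u'r; have eu' : u' = (u' - U_(r) + U_(r))%MM by apply: mon_subU; rewrite -lt0n.
set w := (u' - U_(r))%MM in eu' *.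
have dw : mdeg w = d.-2.
  by have := segment_du'; rewrite {1}eu' mdegD mdeg1; lia.
have w_u' i : (w i <= u' i)%N by rewrite [w i]mnmBE leq_subr.
have wp : w p = 0%N by have := w_u' p; rewrite segment_u'_low //; lia.
split.
- apply: segment_weight => i iX; have u0 := segment_varsPn iX segment_u.
  have ip : (p == i) = false by apply: contraNF iX => /eqP <-; apply: segment_pX.
  by rewrite mnmDE mnm1E ip addn0; have := w_u' i; rewrite mnmBE u0; lia.
- move=> k [g Lg /mnm_lepP le]; have [dg _ _] := Lg; have gp := segment_p_le1 Lg.
  have /lepm_mdeg : (g <= w + U_(p))%MM.
    apply/mnm_lepP => i; have := le i; rewrite !mnmDE mulmnE mnm1E.
    by have [<-|_] := eqVneq p i; rewrite ?wp ?mul0n ?addn0.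
  by rewrite dg mdegD mdeg1 dw; lia.
- move=> i iX; exists (w + U_(i) + U_(p))%MM.
    apply: segment_pU.
    + by rewrite mdegD mdeg1 dw; lia.
    + move=> j jp; rewrite mnmDE zero_r ?vars_r // addn0.
      by have := w_u' j; rewrite segment_u'_low //; lia.
    + by rewrite [X in (_ <= X)%O]eu' lemc_add2r lex_monU // vars_r.
  by rewrite -addmA (addmC U_(i)%MM) addmA; apply: lepm_refl.
- move=> m /addIm <- /segment_mdeg; rewrite mdegD mdeg1 dw; lia.
Qed.

(** Such a monomial of degree [d] is at most [x_r^(d-1) x_z], which is below [v]. *)
Lemma segment_two_vars g : L g -> g p = 0%N -> (g r <= d.-1)%N ->
  (forall i, i != r -> i != z -> g i = 0%N) -> False.
Proof.
move=> Lg gp gr gsupp; have [dg vg _] := Lg.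
suff le : (g <= (U_(r) *+ d.-1 + U_(z))%MM)%O.
  have : (v < v)%O by apply: le_lt_trans vg _; apply: le_lt_trans le vlarge.
  by rewrite ltxx.
have [rz|rz] := eqVneq r z.
  have : (mdeg g <= d.-1)%N; last by rewrite dg; lia.
  rewrite mdegE (bigD1 r) //= big1 ?addn0 // => i ir.
  by apply: gsupp => //; rewrite -rz.
have eg := mon_two_vars rz gsupp; rewrite {1}eg.
have := dg; rewrite {1}eg mdegD !mdegMn !mdeg1 => dg'.
have [k [ed ez]] : exists k, d.-1 = (g r + k)%N /\ g z = k.+1.
  by exists (d.-1 - g r)%N; split; lia.
rewrite ed ez mulmSr addmA lemc_add2l.
have -> : (U_(r) *+ (g r + k) = U_(r) *+ g r + U_(r) *+ k)%MM.
  by apply/mnmP => i; rewrite !(mnmDE, mulmnE) mulnDr.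
rewrite lemc_add2r.
by have := lex_ge_pow (U_(r) *+ k)%MM zmax; rewrite mdegMn mdeg1 mul1n.
Qed.

(** After adding [x_i], the factor [x_r^(d-1)] accommodates generators free of [x_p], and
    [x_z^(d-2) x_p] those containing it. The last condition of [pair_witness] is
    [segment_two_vars]. *)
Lemma pair_witness_large : u' r = 0%N ->
  pair_witness (U_(r) *+ d.-1 + U_(z) *+ d.-2 + U_(p))%MM.
Proof.
move=> u'r; set w := (_ + U_(z) *+ _)%MM.
have wp : w p = 0%N.
  by rewrite mnmDE !mulmnE !zero_r ?segment_p_lt_z.
have ws i : i != r -> i != z -> w i = 0%N.
  move=> ir iz; rewrite mnmDE !mulmnE !mnm1E eq_sym (negPf ir).
  by rewrite eq_sym (negPf iz) !mul0n.
have rz : r != z.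
  apply/negP => /eqP rz; suff : (U_(r) *+ d.-1 + U_(z))%MM = v.
    by move=> e; have := vlarge; rewrite e ltxx.
  have vsupp i : i != p -> i != r -> v i = 0%N.
    move=> ip ir; have := zmax i; rewrite -rz => ir'; apply: vz.
    by move: ip ir ir'; rewrite -!val_eqE /=; lia.
  have pr' : p != r by rewrite pr.
  rewrite (mon_two_vars pr' vsupp) vp mulm0n add0m -rz.
  have := dv; rewrite {1}(mon_two_vars pr' vsupp) mdegD !mdegMn !mdeg1 vp => dv'.
  have -> : v r = d.-1.+1 by lia.
  by rewrite mulmSr.
have wr : w r = d.-1.
  by rewrite mnmDE !mulmnE !mnm1E eqxx eq_sym (negPf rz) mul1n mul0n addn0.
have wz : w z = d.-2.
  by rewrite mnmDE !mulmnE !mnm1E eqxx (negPf rz) mul1n mul0n.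
split.
- apply: segment_weight => i iX; rewrite mnmDE ws ?mnm1E.
  + by have [e|//] := eqVneq p i; move: iX; rewrite -e segment_pX.
  + by apply: contraNneq iX => ->; apply: segment_rX.
  + by apply: contraNneq iX => ->; apply: segment_zX.
- move=> k [g Lg /mnm_lepP le]; have gp := segment_p_le1 Lg.
  have g_w i : i != p -> (g i <= w i)%N.
    move=> ip; have := le i; rewrite mnmDE [(w + _)%MM i]mnmDE mulmnE mnm1E.
    by rewrite [p == i]eq_sym (negPf ip) mul0n !addn0.
  (* A generator free of [x_p] is excluded by [segment_two_vars]. Otherwise [a = g / x_p] has degree
     [d.-1], above the exponent of [x_z] in [w], so it contains [x_r]; as [u'] does not, [a] exceeds
     [u']. *)
  have [gp0|gp0] := eqVneq (g p) 0%N.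
    apply: (segment_two_vars Lg gp0).
      by rewrite -wr; apply: g_w; rewrite eq_sym pr.
    move=> i ir iz; have [-> //|ip] := eqVneq i p.
    by have := g_w i ip; rewrite ws //; lia.
  have gp1 : g p = 1%N by lia.
  have [eg da au az] := segment_sub_p Lg gp1.
  set a := (g - U_(p))%MM in eg da au az.
  have a_w i : i != p -> (a i <= w i)%N.
    by move=> ip; apply: leq_trans (g_w i ip); rewrite mnmBE leq_subr.
  have ar : (0 < a r)%N.
    rewrite lt0n; apply/negP => /eqP ar.
    have : (mdeg a <= d.-2)%N; last by rewrite da; lia.
    rewrite mdegE (bigD1 z) //= big1 ?addn0.
      by rewrite -wz; apply: a_w; rewrite eq_sym pz.
    move=> i iz; have [-> //|ir] := eqVneq i r.
    have [->|ip] := eqVneq i p; first by rewrite az.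
    by have := a_w i ip; rewrite ws //; lia.
  suff : (u' < a)%O by rewrite ltNge au.
  apply: (@lex_lt_at r); rewrite ?da ?segment_du' ?u'r //.
  by move=> j jr; rewrite az // segment_u'_low.
- move=> i iX; have ri := vars_r iX.
  have : i \in X by move: iX; rewrite in_setD1 => /andP[].
  case/segment_varsP => g Lg gi; have [dg vg _] := Lg.
  have eg := mon_subU gi; set b := (g - U_(i))%MM in eg.
  have db : mdeg b = d.-1 by move: dg; rewrite {1}eg mdegD mdeg1; lia.
  have gp := segment_p_le1 Lg.
  (* From a generator [g] containing [x_i]: if it is free of [x_p], [x_r^(d-1) x_i] is at least [g];
     otherwise [x_z^(d-2) x_i x_p] is at most [g]. Either one is the required generator. *)
  have [gp0|gp0] := eqVneq (g p) 0%N.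
    have g0 j : (j <= p)%N -> g j = 0%N.
      rewrite leq_eqVlt => /orP[/eqP/val_inj -> //|]; exact: segment_low.
    exists (U_(r) *+ d.-1 + U_(i))%MM.
      apply: segment_of_eq0.
      + by rewrite mdegD mdegMn !mdeg1; lia.
      + by move=> j jp; rewrite mnmDE mulmnE !zero_r.
      + apply: le_trans vg _; rewrite eg lemc_add2l -db; apply: lex_le_pow => j jr.
        by rewrite mnmBE g0.
    apply/mnm_lepP => j; rewrite /w !mnmDE; lia.
  have gp1 : g p = 1%N by lia.
  have [eg' da au az] := segment_sub_p Lg gp1.
  set a := (g - U_(p))%MM in eg' da au az.
  have ai : a i != 0%N.
    by rewrite mnmBE mnm1E; case: (eqVneq p i) ri => [<-|_] //; rewrite ?ltnn ?subn0.
  have ea := mon_subU ai; have dc : mdeg (a - U_(i))%MM = d.-2.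
    by move: da; rewrite {1}ea mdegD mdeg1; lia.
  exists (U_(z) *+ d.-2 + U_(i) + U_(p))%MM.
    apply: segment_pU.
    + by rewrite mdegD mdegMn !mdeg1; lia.
    + by move=> j jp; rewrite mnmDE mulmnE !zero_r ?segment_p_lt_z.
    + by apply: le_trans au; rewrite [X in (_ <= X)%O]ea lemc_add2l -dc; apply: lex_ge_pow.
  by apply/mnm_lepP => j; rewrite /w !mnmDE; lia.
- move=> m /addIm <- [g Lg /mnm_lepP le].
  have g_w i : i != z -> (g i <= w i)%N.
    by move=> iz; have := le i; rewrite mnmDE mnm1E [z == i]eq_sym (negPf iz) addn0.
  apply: (segment_two_vars Lg).
  + by have := g_w p; rewrite pz wp => /(_ isT); lia.
  + by rewrite -wr; apply: g_w.
  + by move=> i ir iz; have := g_w i iz; rewrite ws //; lia.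
Qed.

End LargeLast.

Lemma ex_pair_witness : exists w, pair_witness w.
Proof.
have [small|large] := leP v (U_(r) *+ d.-1 + U_(z))%MM.
  by eexists; apply: pair_witness_small small.
have [u'r|u'r] := posnP (u' r).
  by eexists; apply: pair_witness_large.
by eexists; apply: pair_witness_mid.
Qed.

End ReducedSegment.
End LexSegments.

(** * From reduced lexsegments to arbitrary ones *)

Lemma mnm_le_mdeg n (a : 'X_{1..n}) i : (a i <= mdeg a)%N.
Proof. by rewrite mdegE (bigD1 i) //= leq_addr. Qed.

Lemma minimal_depth_reduced (K : fieldType) n d (mu u v : 'X_{1..n}) (p : 'I_n) :
    mdeg u = d -> mdeg v = d -> (0 < u p)%N -> v p = 0%N ->
    (forall j : 'I_n, (j < p)%N -> u j = 0%N) ->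
    (forall j : 'I_n, (j < p)%N -> v j = 0%N) ->
  minimal_depth (mon_ideal (shift mu (up_closure (segment d u v))) : set {mpoly K[n]}).
Proof.
move=> du dv up vp uz vz.
have d_gt0 : (0 < d)%N by rewrite -du (leq_trans up) ?mnm_le_mdeg.
have n_gt0 : (0 < n)%N := leq_ltn_trans (leq0n p) (ltn_ord p).
have zlt : (n.-1 < n)%N by rewrite prednK.
pose z := Ordinal zlt; have zmax (i : 'I_n) : (i <= z)%N.
  by rewrite /= -ltnS prednK.
set H := up_closure _; pose X := segment_vars d u v.
have upH : upset H := @upset_closure _ _.
have freeH := @segment_free n d u v.
have Hmdeg := @segment_mdeg n d u v.
have Lu := segment_u du dv up vp uz vz.
have Hu : H u by exists u => //; apply: lepm_refl.
have bound m : shift mu H m -> exists g : 'X_{1..n},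
    [/\ shift mu H g, (g <= m)%MM & forall i, (g i <= mdeg mu + d)%N].
  move=> /shiftP[h [g Lg /mnm_lepP le] ->]; exists (mu + g)%MM; split.
  - by apply/shiftD; exists g => //; apply: lepm_refl.
  - by apply/mnm_lepP => i; rewrite !mnmDE leq_add2l.
  - by case: Lg => <- _ _ i; rewrite -mdegD mnm_le_mdeg.
have proper : ~ shift mu H 0%MM.
  move/shiftP => [h Hh /(congr1 mdeg)]; rewrite mdeg0 mdegD.
  by have := Hmdeg h Hh; lia.
have exH : exists m, H m by exists u.
have pX : p \in X := segment_pX du dv up vp uz vz.
have [dsmall|dbig] := boolP ((d == 1%N) || (v <= (u - U_(p) + U_(z))%MM)%O).
  have hyp : d = 1%N \/ (v <= (u - U_(p) + U_(z))%MM)%O.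
    by case/orP: dsmall => [/eqP ->|]; [left|right].
  have [wX nHw wH] := segment_socle du dv d_gt0 up vp uz vz zmax hyp.
  exact: (minimal_depth_socle K upH freeH exH bound proper pX wX nHw wH).
move: dbig; rewrite negb_or -ltNge => /andP[d1 vbig].
have d_gt1 : (1 < d)%N by rewrite ltn_neqAle eq_sym d1.
have zX : z \in X := segment_zX du dv d_gt0 up vp vz zmax d_gt1 vbig.
have pz : p != z.
  by rewrite -val_eqE neq_ltn (segment_p_lt_z dv d_gt0 vp vz zmax).
have [w [wX nHw wH wpz]] := ex_pair_witness du dv d_gt0 up vp uz vz zmax d_gt1 vbig.
(* The monomial [u / x_p] is outside [H] while [u] is in it, which forces an associated prime
   containing [x_p]. *)
apply: (minimal_depth_pair (t := (u - U_(p))%MM) K upH freeH exH bound proper pX zX pz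
  _ _ _ wX nHw wH wpz).
- exact: (segment_pz_colon du dv d_gt0 up vp uz vz zmax d_gt1 vbig).
- by move/Hmdeg; rewrite (segment_du' du dv d_gt0 up vp); lia.
- by rewrite -(segment_uE up).
Qed.

Lemma lexsegment_segment n d (u v : 'X_{1..n}) : mdeg u = d -> mdeg v = d ->
  lexsegment d u v = segment d u v.
Proof.
move=> du dv; apply/seteqP; split=> m [dm].
  by rewrite !lex_geE ?dm ?du ?dv //; split.
by move=> vm mu; split=> //; rewrite lex_geE ?dm ?du ?dv.
Qed.

Lemma up_closure_shift n (mu : 'X_{1..n}) (L L' : set 'X_{1..n}) :
  (forall m, L m <-> exists2 g, L' g & m = (mu + g)%MM) ->
  up_closure L = shift mu (up_closure L').
Proof.
move=> LL'; apply/seteqP; split=> [m [_ /LL'[g L'g ->] le]|_ /shiftP[h [g L'g le] ->]].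
  apply/shiftP; exists (m - mu)%MM; last first.
    by rewrite addmC submK //; apply: lepm_trans le; apply: lem_addr.
  exists g => //; apply/mnm_lepP => i; have /mnm_lepP/(_ i) := le.
  by rewrite mnmDE mnmBE; lia.
exists (mu + g)%MM; first by apply/LL'; exists g.
by apply/mnm_lepP => i; rewrite !mnmDE leq_add2l; apply/mnm_lepP.
Qed.

Theorem theorem1p6 (K : fieldType) (n d : nat) (u v : 'X_{1..n})
  (hd : (2 <= d)%N) (hu : mdeg u = d) (hv : mdeg v = d) (huv : lex_ge u v) :
  minimal_depth (lexsegment_ideal K d u v).
Proof.
rewrite /lexsegment_ideal monomial_ideal_genE lexsegment_segment //.
move: huv; rewrite lex_geE ?hu ?hv // le_eqVlt => /orP[/eqP vu|vu].
  (* For [u = v] the ideal is principal: [x^u] times the whole ring, in which no variable occurs. *)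
  rewrite vu (@up_closure_shift _ u _ [set 0%MM]); last first.
    move=> m; split=> [[_ um mu]|[_ -> ->]]; last by rewrite addm0; split.
    by exists 0%MM; rewrite // addm0; apply/eqP; rewrite eq_le um mu.
  have all0 m : up_closure [set 0%MM] m by exists 0%MM => //; apply/mnm_lepP => i; rewrite mnm0E.
  apply: (@minimal_depth_principal _ _ u _ finset.set0 d) => //.
  - by exists 0%MM.
  - move=> m [um _]; exists u; split=> // [|i]; last by rewrite -hu mnm_le_mdeg.
    by split; rewrite ?lepm_refl.
  - by case=> /lepm_mdeg; rewrite hu mdeg0; lia.
  - have [|i _] := @mon_ex_var n u; first by rewrite hu; lia.
    exact: leq_ltn_trans (leq0n i) (ltn_ord i).
have /(ltmcP (etrans hv (esym hu)))[p vup ltp] := vu.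
(* Since [v p < u p], dividing by the power [v p] of [x_p] frees the last monomial of [x_p] but not
   the first. *)
pose mu := [multinom if (j < p)%N then u j else if j == p then v j else 0%N | j < n].
have mu_u : (mu <= u)%MM.
  apply/mnm_lepP => i; rewrite mnmE; case: ifP => // _.
  by case: eqP => [->|//]; apply: ltnW.
have mu_v : (mu <= v)%MM.
  apply/mnm_lepP => i; rewrite mnmE; case: ifP => [/vup ->|_] //.
  by case: eqP.
have eu : u = (mu + (u - mu))%MM by rewrite addmC submK.
have ev : v = (mu + (v - mu))%MM by rewrite addmC submK.
rewrite (@up_closure_shift _ mu _ (segment (d - mdeg mu) (u - mu) (v - mu))).
  apply: (@minimal_depth_reduced _ _ _ _ _ _ p).
  - by rewrite -hu [in RHS]eu mdegD addKn.
  - by rewrite -hv [in RHS]ev mdegD addKn.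
  - by rewrite mnmBE mnmE ltnn eqxx subn_gt0.
  - by rewrite mnmBE mnmE ltnn eqxx subnn.
  - by move=> j jp; rewrite mnmBE mnmE jp subnn.
  - by move=> j jp; rewrite mnmBE mnmE jp vup // subnn.
move=> m; split=> [[dm vm mu']|[g [dg vg gu] ->]]; last first.
  split.
  - by rewrite mdegD dg subnKC // -hu lepm_mdeg.
  - by rewrite ev lemc_add2r.
  - by rewrite eu lemc_add2r.
(* [u] and [v] agree before [p], so dropping below [u] at an earlier place would mean dropping below
   [v]. *)
have m_u (j : 'I_n) : (j < p)%N -> m j = u j.
  move=> jp; move: mu'; rewrite le_eqVlt => /orP[/eqP -> //|].
  case/(ltmcP (etrans dm (esym hu))) => i ei lti.
  have [ij|ji] := leqP i j; last exact: ei.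
  have : (m < v)%O.
    have ip := leq_ltn_trans ij jp.
    apply: (@lex_lt_at _ i); first by rewrite dm hv.
      by move=> k ki; rewrite ei // vup // (ltn_trans ki).
    by rewrite vup.
  by rewrite ltNge vm.
have m_vp : (v p <= m p)%N.
  move: vm; rewrite le_eqVlt => /orP[/eqP -> //|].
  case/(ltmcP (etrans hv (esym dm))) => i ei lti.
  have [ip|] := ltnP i p.
    by move: lti; rewrite vup // m_u // ltnn.
  by rewrite leq_eqVlt => /orP[/eqP/val_inj ->|/ei ->] //; apply: ltnW.
have mu_m : (mu <= m)%MM.
  apply/mnm_lepP => i; rewrite mnmE; case: ifP => [/m_u ->|_] //.
  by case: eqP => [->|].
have em : m = (mu + (m - mu))%MM by rewrite addmC submK.
exists (m - mu)%MM => //; split.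
- by rewrite -dm [in RHS]em mdegD addKn.
- by rewrite -(lemc_add2r mu) -em -ev.
- by rewrite -(lemc_add2r mu) -em -eu.
Qed.
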